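(* Let $R=k[x_0,\ldots,x_n]$ be a polynomial ring over a field $k$ of any characteristic, let $1\le c<s$ be integers, and let $\mathcal F=\{F_1,\ldots,F_s\}$ be a set of $s$ forms in $R$ such that any $c+1$ of them form a regular sequence. Let $I_c=\bigcap_{1\le j_1<\cdots<j_c\le s}(F_{j_1},\ldots,F_{j_c})$. Then, for any $m\ge 1$: (1) the minimal number of generators $\mu(I_c^{(m)})$ of $I_c^{(m)}$ is $$\sum_{B=\{b_1,\ldots,b_h\}\subseteq[c]}|\mathbb S_B|\binom{s}{c-b_h}\binom{s-c+b_h}{b_h-b_{h-1}}\binom{s-c+b_{h-1}}{b_{h-1}-b_{h-2}}\cdots\binom{s-c+b_2}{b_2-b_1},$$ where $\mathbb S_B$ is the set of all distinct positive solutions to the Diophantine equation $b_1x_1+\cdots+b_hx_h=m$; (2) the symbolic defect $\mathrm{sdefect}(I_c,m)$ of $I_c$ is $$\left(\sum_{B=\{b_1,\ldots,b_h\}\subseteq[c]}|\mathbb S_B|\binom{s}{c-b_h}\binom{s-c+b_h}{b_h-b_{h-1}}\binom{s-c+b_{h-1}}{b_{h-1}-b_{h-2}}\cdots\binom{s-c+b_2}{b_2-b_1}\right)-\binom{s}{c-1}.$$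
   Context: For a homogeneous ideal $I\subseteq R$ and $m\ge 1$, the symbolic power is $I^{(m)}=\bigcap_{P\in \mathrm{Ass}(R/I)}(I^mR_P\cap R)$. $\mu(U)$ denotes the minimal number of generators of a finitely generated graded $R$-module $U$, and $\mathrm{sdefect}(I,m):=\mu(I^{(m)}/I^m)$. $[c]=\{1,2,\ldots,c\}$; the sums run over the nonempty subsets $B\subseteq[c]$, whose elements are written in increasing order, $1\le b_1<b_2<\cdots<b_h\le c$. A positive solution is an ordered tuple $(x_1,\ldots,x_h)$ of positive integers satisfying the equation. When $h=1$ the product of binomials is just $\binom{s}{c-b_1}$. *)

(* Defs.v *)
From HB Require Import structures.
From mathcomp Require Import all_boot all_order all_algebra.
From mathcomp Require Import classical_sets.
From mathcomp Require Import mpoly.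

Set Implicit Arguments.
Unset Strict Implicit.
Unset Printing Implicit Defensive.

Import GRing.Theory.
Local Open Scope classical_set_scope.
Local Open Scope ring_scope.

Local Notation "x %:F" := (@FracField.tofrac _ x) : ring_scope.

(* Ideals are [Prop]-valued sets: the boolean [idealr_closed] predicates of
   [ring_quotient] presuppose decidable membership and exclude the unit ideal. *)
Definition is_ideal (R : comNzRingType) (J : set R) : Prop :=
  [/\ J 0,
      forall x y, J x -> J y -> J (x + y)
    & forall a x, J x -> J (a * x)].

Definition ideal_gen (R : comNzRingType) (S : set R) : set R :=
  smallest (@is_ideal R) S.

Definition ideal_exp (R : comNzRingType) (J : set R) (m : nat) : set R :=
  ideal_gen [set \prod_(i < m) f i | f in [set f : 'I_m -> R | forall i, J (f i)]].

Definition is_prime_ideal (R : comNzRingType) (P : set R) : Prop :=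
  [/\ is_ideal P, ~ P 1 & forall a b, P (a * b) -> P a \/ P b].

(* Ass(R/J): the primes that are the annihilator of the class in R/J of some
   [x] in R. *)
Definition associated_primes (R : comNzRingType) (J : set R) : set (set R) :=
  [set P | is_prime_ideal P /\ exists x, P = [set a | J (a * x)]].

(* R_P, as a subring of the fraction field of the domain R. *)
Definition localization (R : idomainType) (P : set R) : set {fraction R} :=
  [set z | exists a u, ~ P u /\ z = a%:F / u%:F].

(* J R_P, the ideal of R_P generated by the image of J. *)
Definition ideal_localization (R : idomainType) (J P : set R) :
    set {fraction R} :=
  [set z | exists (q : nat) (a : 'I_q -> R) (y : 'I_q -> {fraction R}),
    [/\ forall i, J (a i), forall i, localization P (y i)
      & z = \sum_(i < q) (a i)%:F * y i]].

Definition symbolic_power (R : idomainType) (J : set R) (m : nat) : set R :=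
  \bigcap_(P in associated_primes J)
    [set f | ideal_localization (ideal_exp J m) P f%:F].

(* For ideals N `<=` M, the classes of the [u i] generate the module M/N. *)
Definition generates_quotient (R : comNzRingType) (M N : set R) (q : nat)
    (u : 'I_q -> R) : Prop :=
  M = ideal_gen (range u `|` N).

(* mu(M/N) = q, where N `<=` M are ideals. *)
Definition min_gens_quotient (R : comNzRingType) (M N : set R) (q : nat) :
    Prop :=
  (exists u : 'I_q -> R, generates_quotient M N u) /\
  (forall q' (u : 'I_q' -> R), generates_quotient M N u -> (q <= q')%N).

(* mu(J) = q; J is J/0. *)
Definition min_gens (R : comNzRingType) (J : set R) (q : nat) : Prop :=
  min_gens_quotient J [set 0] q.

(* sdefect(J, m) = q. *)
Definition sdefect (R : idomainType) (J : set R) (m q : nat) : Prop :=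
  min_gens_quotient (symbolic_power J m) (ideal_exp J m) q.

Definition regular_sequence (R : comNzRingType) (r : nat) (f : 'I_r -> R) :
    Prop :=
  (forall i : 'I_r,
     let J := ideal_gen [set f j | j in [set j : 'I_r | (j < i)%N]] in
     forall g, J (g * f i) -> J g) /\
  ~ ideal_gen (range f) 1.

(* I_c; a c-element set of indices is j_1 < ... < j_c. *)
Definition star_ideal (R : comNzRingType) (s c : nat) (F : 'I_s -> R) : set R :=
  \bigcap_(A in [set A : {set 'I_s} | #|A| = c])
    ideal_gen [set F j | j in [set` A]].

(* The elements b_1 < ... < b_h of B; [i : 'I_c] stands for i + 1 in [c]. *)
Definition elements (c : nat) (B : {set 'I_c}) : seq nat :=
  [seq (val i).+1 | i <- enum B].

(* |S_B| for [b] the list of elements of B. Since every b_i is positive, a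
   solution has all its entries at most m. *)
Definition num_solutions (b : seq nat) (m : nat) : nat :=
  #|[pred x : (size b).-tuple 'I_m.+1 |
      [forall i, (0 < tnth x i)%N] &&
      (\sum_(i < size b) nth 0%N b i * tnth x i == m)%N]|.

(* Here b_(i+1) is [nth 0 b i] and b_h is [last 0 b]. *)
Definition num_generators (s c m : nat) : nat :=
  (\sum_(B : {set 'I_c} | B != finset.set0)
     let b := elements B in
     num_solutions b m * 'C(s, c - last 0 b) *
     \prod_(i < (size b).-1)
       'C(s - c + nth 0 b i.+1, nth 0 b i.+1 - nth 0 b i))%N.

(* Main.v *)
From HB Require Import structures.
From mathcomp Require Import boolp classical_sets.
From mathcomp Require Import all_boot all_order all_algebra perm.
From mathcomp Require Import mpoly.
From mathcomp Require Import zify ring.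
Require Import Defs.

Set Implicit Arguments.
Unset Strict Implicit.
Unset Printing Implicit Defensive.

Import Order.TTheory GRing.Theory.
Local Open Scope ring_scope.

(** Write [e = s - c] and, for an exponent vector [a], let [F^a] be the product
    of the [F_j ^+ a_j].  Let [L_m] be the ideal generated by the monomials [F^a]
    such that [a] has sum at least [m] on every set of [c] indices
    ([star_monomials]).  The theorem follows from three facts.

    The symbolic power [I_c^(m)] is [L_m].  An associated prime [P] of [I_c]
    contains no [F_j] with [j] outside some [A] of [c] elements, because each
    such [F_j] is a nonzerodivisor modulo [(F_i : i in A)]; inverting these
    [F_j] puts the other [c] forms in [I_c R_P], so every generator of [L_m] lies
    in [I_c^m R_P] ([star_monomials_symbolic]).  Conversely, let [f] be in
    [I_c^(m+1)]; by induction [f] is a combination of the minimal generators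
    [F^a] of [L_m], with coefficients [r_a].  If [a] has sum [m] on [A] and
    [r_a] is not in [(F_i : i in A)], then a prime of the form
    [(F_i : i in A) : d r_a] is associated to [I_c], some [u] outside it sends
    [f] into [I_c^(m+1)], which lies in [L_(m+1)], and the syzygy lemma
    [star_syzygy] puts [u r_a] in [(F_i : i in A)], hence [u] in the prime.  So
    [r_a] is in [(F_i : i in A)] for all [A] on which [a] has sum [m], and
    [star_tight_mul] gives [r_a F^a] in [L_(m+1)].

    The two lemmas just used only need monomial ideals.  For [star_syzygy], the
    generators other than [F^a], as well as [L_(m+1)], lie in the ideal of the
    powers [F_i ^+ (a_i + 1)], [i] in [A], and the colon of that ideal by the
    restriction of [F^a] to [A] is [(F_i : i in A)] ([regular_family_colon]).
    For [star_tight_mul], the sets [A] on which [a] has sum [m] consist of all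
    the indices where [a] is not maximal together with any subset of the right
    cardinality of the others, and the intersection of the ideals
    [(F_i : i in A)] over such a family of sets is computed by induction in
    [star_intersection]; the case where all sets occur is [I_c = L_1].

    The number of generators follows.  By the syzygy lemma the relations between
    the minimal [F^a] have coefficients without constant term, so evaluation at
    the origin turns any generating family into a factorization of an identity
    matrix ([generators_bound]).  For the symbolic defect, [I_c^m] is generated
    by products of [m] squarefree monomials of degree [e + 1]; by degree, the
    only minimal exponents among them are [m] times an indicator
    ([power_exponent_min]), and there are ['C(s, c - 1)] of these.

    Finally the minimal exponents are counted by stripping the indicator of
    their support, which gives a recursion ([min_exponent_count]); the sum in
    the statement satisfies the same recursion, by removing from [B] its largest
    element, one copy at a time ([chain_count_step]). *)

(** * Ideals and nonzerodivisors *)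

Section Ideals.
Variable R : comNzRingType.
Implicit Types (S J K : set R) (f g y z : R).

Lemma ideal_genP S : is_ideal (ideal_gen S).
Proof.
split=> [J [[] //]|x y Sx Sy J SJ|a x Sx J SJ].
  by case: (SJ) => -[_ JD _] _; apply: JD; [exact: Sx|exact: Sy].
by case: (SJ) => -[_ _ JM] _; apply: JM; exact: Sx.
Qed.

Lemma ideal_gen_mem S f : S f -> ideal_gen S f.
Proof. by move=> Sf J [_]; exact. Qed.

Lemma ideal_gen_sub S J : is_ideal J -> (forall f, S f -> J f) ->
  forall f, ideal_gen S f -> J f.
Proof. by move=> idJ SJ f; apply. Qed.

Lemma ideal0 J : is_ideal J -> J 0. Proof. by case. Qed.

Lemma idealD J : is_ideal J -> forall f g, J f -> J g -> J (f + g).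
Proof. by case. Qed.

Lemma idealM J : is_ideal J -> forall g f, J f -> J (g * f).
Proof. by case. Qed.

Lemma idealMr J : is_ideal J -> forall f g, J f -> J (f * g).
Proof. by move=> idJ f g Jf; rewrite mulrC; apply: idealM. Qed.

Lemma idealB J : is_ideal J -> forall f g, J f -> J g -> J (f - g).
Proof.
move=> idJ f g Jf Jg; apply: idealD => //; rewrite -mulN1r; exact: idealM.
Qed.

Lemma ideal_sum J (I : Type) (r : seq I) (P : pred I) (E : I -> R) :
  is_ideal J -> (forall i, P i -> J (E i)) -> J (\sum_(i <- r | P i) E i).
Proof.
by move=> idJ JE; apply: big_ind => //; [exact: ideal0|exact: idealD].
Qed.

Definition adjoin K y : set R := [set f | exists g, K (f - g * y)].

Lemma adjoinP K y : is_ideal K -> is_ideal (adjoin K y).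
Proof.
move=> idK; split; first by exists 0; rewrite mul0r subr0; apply: ideal0.
  move=> f g [a Ka] [b Kb].
  exists (a + b); suff -> : f + g - (a + b) * y = f - a * y + (g - b * y).
    exact: idealD.
  by ring.
move=> a f [b Kb]; exists (a * b); suff -> : a * f - a * b * y = a * (f - b * y).
    exact: idealM.
  by ring.
Qed.

Lemma ideal_genU1 S y : ideal_gen (S `|` [set y]) = adjoin (ideal_gen S) y.
Proof.
apply/seteqP; split.
  apply: ideal_gen_sub; first exact/adjoinP/ideal_genP.
  move=> f [Sf|->].
    by exists 0; rewrite mul0r subr0; apply: ideal_gen_mem.
  by exists 1; rewrite mul1r subrr; exact: ideal0 (ideal_genP _).
move=> f [g Sg]; rewrite -[f](subrK (g * y)).
apply: (idealD (ideal_genP _)).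
  move: Sg; apply: ideal_gen_sub; first exact: ideal_genP.
  by move=> h Sh; apply: ideal_gen_mem; left.
by apply: (idealM (ideal_genP _)); apply: ideal_gen_mem; right.
Qed.

Definition colon K y : set R := [set f | K (f * y)].

Lemma colonP K y : is_ideal K -> is_ideal (colon K y).
Proof.
move=> idK; split; rewrite /colon /=; first by rewrite mul0r; apply: ideal0.
  by move=> f g Kf Kg; rewrite mulrDl; apply: idealD.
by move=> a f Kf; rewrite -mulrA; apply: idealM.
Qed.

Definition nonzerodivisor K y := forall f, K (f * y) -> K f.

Lemma nonzerodivisorX K y n : nonzerodivisor K y -> nonzerodivisor K (y ^+ n).
Proof.
move=> Ky; elim: n => [|n IHn] f; first by rewrite expr0 mulr1.
by rewrite exprS mulrA => /IHn /Ky.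
Qed.

Lemma nonzerodivisor_prod K (I : finType) (P : pred I) (E : I -> R) :
  (forall i, P i -> nonzerodivisor K (E i)) ->
  nonzerodivisor K (\prod_(i | P i) E i).
Proof.
move=> KE; apply: (big_ind (nonzerodivisor K)) => //.
  by move=> f; rewrite mulr1.
by move=> y z Ky Kz f; rewrite mulrA => /Kz /Ky.
Qed.

(** If [f z = g y^(n+2)] modulo [K], then [f = h y] modulo [K + (y)] with a new
    factor [h]; cancelling [y] reduces the exponent by one. *)
Lemma nonzerodivisor_adjoinX K y z n : is_ideal K ->
  nonzerodivisor K y -> nonzerodivisor (adjoin K y) z ->
  nonzerodivisor (adjoin K (y ^+ n.+1)) z.
Proof.
move=> idK Ky Kz; elim: n => [|n IHn]; first by rewrite expr1.
move=> f [g Kg].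
have [h Kh] : adjoin K y f.
  by apply: Kz; exists (g * y ^+ n.+1); rewrite -mulrA -exprSr.
have : K ((h * z - g * y ^+ n.+1) * y).
  suff -> : (h * z - g * y ^+ n.+1) * y =
            f * z - g * y ^+ n.+2 - z * (f - h * y).
    by apply: idealB => //; apply: idealM.
  by rewrite !exprS; ring.
move/Ky => Kgh; have [l Kl] : adjoin K (y ^+ n.+1) h by apply: IHn; exists g.
exists l; suff -> : f - l * y ^+ n.+2 = f - h * y + y * (h - l * y ^+ n.+1).
  by apply: idealD => //; apply: idealM.
by rewrite !exprS; ring.
Qed.

End Ideals.

(** * Families of which every c + 1 members are regular *)

Section RegularFamily.
Variables (R : comNzRingType) (s : nat).
Implicit Types (x : 'I_s -> R) (A B D T : {set 'I_s}) (f g : R).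

Definition gen x A : set R := ideal_gen [set x j | j in [set` A]].

Lemma gen_ideal x A : is_ideal (gen x A). Proof. exact: ideal_genP. Qed.

Lemma gen_mem x A j : j \in A -> gen x A (x j).
Proof. by move=> Aj; apply: ideal_gen_mem; exists j. Qed.

Lemma eq_gen x y A : {in A, x =1 y} -> gen x A = gen y A.
Proof.
move=> xy; rewrite /gen; congr ideal_gen; apply/seteqP; split=> f [j Aj <-].
  by exists j => //; rewrite xy.
by exists j => //; rewrite xy.
Qed.

Lemma gen_sub x A J : is_ideal J -> (forall j, j \in A -> J (x j)) ->
  forall f, gen x A f -> J f.
Proof.
by move=> idJ AJ; apply: ideal_gen_sub => // f [j Aj <-]; exact: AJ.
Qed.

Lemma genD1 x A i : i \in A -> gen x A = adjoin (gen x (A :\ i)) (x i).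
Proof.
move=> Ai; rewrite /gen -ideal_genU1; congr ideal_gen; apply/seteqP; split.
  move=> f [j /= Aj <-]; have [->|ji] := eqVneq j i; [by right|left].
  by exists j => //=; rewrite !inE ji.
move=> f [[j /= + <-]|->]; last by exists i.
by rewrite !inE => /andP[_ Aj]; exists j.
Qed.

(** Every ordering of every subfamily of [c + 1] members is a regular sequence,
    up to properness of the ideal. *)
Definition regular_family x c := forall A j, (#|A| <= c)%N -> j \notin A ->
  nonzerodivisor (gen x A) (x j).

(** Induction on the number of exponents above [1]: for such an index [i], the
    element [x i] is a nonzerodivisor modulo the other powers and [x j] is one
    after lowering the exponent of [x i] to [1], so [nonzerodivisor_adjoinX]
    raises it again. *)
Lemma regular_family_powers x c (n : 'I_s -> nat) A j :
  regular_family x c -> (#|A| <= c)%N -> j \notin A ->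
  nonzerodivisor (gen (fun i => x i ^+ (n i).+1) A) (x j).
Proof.
move=> reg; have [k] := ubnP #|[set i in A | n i != 0%N]|.
elim: k => // k IHk in n A j *; rewrite ltnS => leAk Ac jA.
have [A1|[i]] := set_0Vmem [set i in A | n i != 0%N].
  rewrite (@eq_gen _ x); first exact: reg.
  move=> i Ai; have : i \notin [set i in A | n i != 0%N] by rewrite A1 inE.
  by rewrite inE Ai negbK => /eqP ->; rewrite expr1.
rewrite inE => /andP[Ai ni].
have ltAk : (#|[set i in A | n i != 0%N] :\ i| < k)%N.
  by move: leAk; rewrite (cardsD1 i) !inE Ai ni.
rewrite (genD1 _ Ai); apply: nonzerodivisor_adjoinX; first exact: gen_ideal.
  apply: IHk; last by rewrite !inE eqxx.
    apply: leq_trans ltAk; rewrite ltnS; apply: subset_leq_card.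
    by apply/subsetP=> l; rewrite !inE -andbA.
  by apply: leq_trans Ac; apply: subset_leq_card; exact: subsetDl.
pose n' l := if l == i then 0%N else n l.
have := IHk n' A j; rewrite (genD1 _ Ai) /n' eqxx expr1.
rewrite (@eq_gen _ (fun i => x i ^+ (n i).+1)); last first.
  by move=> l; rewrite !inE => /andP[/negPf ->].
apply=> //; apply: leq_trans ltAk; rewrite ltnS; apply: subset_leq_card.
apply/subsetP=> l; rewrite !inE; have [->|] := eqVneq l i; last by [].
by rewrite andbF.
Qed.

(** In [f P x_i^n_i = g x_i^(n_i+1)] modulo the other powers, [x_i^n_i] cancels,
    which replaces the exponent of [x_i] by [0] on both sides; the exponents are
    removed one index at a time. *)
Lemma regular_family_colon x c (n : 'I_s -> nat) A f :
  regular_family x c -> (#|A| <= c)%N ->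
  gen (fun i => x i ^+ (n i).+1) A (f * \prod_(i in A) x i ^+ n i) ->
  gen x A f.
Proof.
move=> reg Ac; have [k] := ubnP #|[set i in A | n i != 0%N]|.
elim: k => // k IHk in n f *; rewrite ltnS => leAk.
have [A1|[i]] := set_0Vmem [set i in A | n i != 0%N].
  have n0 i : i \in A -> n i = 0%N.
    move=> Ai; have : i \notin [set i in A | n i != 0%N] by rewrite A1 inE.
    by rewrite inE Ai negbK => /eqP.
  rewrite big1 ?mulr1 => [|i Ai]; last by rewrite n0.
  by rewrite (@eq_gen _ x) // => i /n0 ->; rewrite expr1.
rewrite inE => /andP[Ai ni].
have ltAk : (#|[set i in A | n i != 0%N] :\ i| < k)%N.
  by move: leAk; rewrite (cardsD1 i) !inE Ai ni.
rewrite (genD1 _ Ai) (bigD1 i) //= => -[g].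
pose n' l := if l == i then 0%N else n l.
set P := \prod_(_ in _ | _) _.
have -> : f * (x i ^+ n i * P) - g * x i ^+ (n i).+1 =
  (f * P - g * x i) * x i ^+ n i by rewrite !exprS; ring.
move=> Kf; apply: (IHk n').
  apply: leq_trans ltAk; rewrite ltnS; apply: subset_leq_card.
  apply/subsetP=> l; rewrite !inE /n'; have [->|] := eqVneq l i; last by [].
  by rewrite andbF.
rewrite (genD1 _ Ai) (bigD1 i) //= {2 3}/n' eqxx expr0 mul1r expr1.
rewrite (eq_bigr (fun l => x l ^+ n l)); last first.
  by move=> l /andP[_ /negPf]; rewrite /n' => ->.
exists g; rewrite (@eq_gen _ (fun i => x i ^+ (n i).+1)); last first.
  by move=> l; rewrite !inE /n' => /andP[/negPf ->].
suff Ki : nonzerodivisor (gen (fun i => x i ^+ (n i).+1) (A :\ i)) (x i).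
  exact: nonzerodivisorX Ki _ Kf.
apply: (regular_family_powers reg).
  by apply: leq_trans Ac; apply: subset_leq_card; exact: subsetDl.
by rewrite !inE eqxx.
Qed.

Definition star_gens x A T k : set R :=
  [set x j | j in [set` A]] `|`
  [set \prod_(j in D) x j | D in [set D : {set 'I_s} | D \subset T /\ #|D| = k]].

(** Induction on [T], removing one index [i].  The sets [B] that contain [i]
    give, with [i] moved to [A], an expression [f = g x_i + h] with [h] of the
    desired form; the sets [B] that do not contain [i] give that [g x_i], and
    hence [g], lies in the intersection for [T :\ i]. *)
Lemma star_intersection x c A T p f : regular_family x c ->
  [disjoint A & T] -> (#|A| + p <= c)%N -> (p <= #|T|)%N ->
  (forall B, B \subset T -> #|B| = p -> gen x (A :|: B) f) ->
  ideal_gen (star_gens x A T (#|T| - p).+1) f.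
Proof.
move=> reg; have [k] := ubnP #|T|.
elim: k => // k IHk in A T p f *; rewrite ltnS => leTk dAT Apc pT fB.
have [p0|p0] := posnP p.
  have := fB _ (sub0set _); rewrite p0 cards0 setU0 => /(_ erefl).
  apply: gen_sub; first exact: ideal_genP.
  by move=> j Aj; apply: ideal_gen_mem; left; exists j.
have [pT'|ltpT] := eqVneq p #|T|.
  have := fB _ (subxx _) (esym pT'); apply: gen_sub; first exact: ideal_genP.
  move=> j /setUP[Aj|Tj]; apply: ideal_gen_mem; [by left; exists j|right].
  exists [set j] => /=; last by rewrite big_set1.
  by rewrite sub1set cards1 pT' subnn.
have {}ltpT : (p < #|T|)%N by rewrite ltn_neqAle ltpT.
have /card_gt0P[i Ti] : (0 < #|T|)%N by apply: leq_trans ltpT.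
have iA : i \notin A.
  by apply/negP => Ai; move/disjointFr: dAT => /(_ _ Ai); rewrite Ti.
have cT : #|T| = #|T :\ i|.+1 by rewrite (cardsD1 i) Ti.
have dAT' : [disjoint A & T :\ i].
  by apply: disjointWr dAT; exact: subsetDl.
(* The degree of the monomials is unchanged: T and p both decrease by one. *)
have : ideal_gen (star_gens x (i |: A) (T :\ i) (#|T| - p).+1) f.
  have -> : (#|T| - p = #|T :\ i| - p.-1)%N by lia.
  apply: IHk; rewrite ?cardsU1 ?iA; try lia.
    rewrite disjoint_sym disjoints_subset; apply/subsetP=> j.
    rewrite !inE negb_or => /andP[-> /= Tj].
    by apply/negP => Aj; move/disjointFr: dAT => /(_ _ Aj); rewrite Tj.
  move=> B BT cB; have iB : i \notin B.
    by apply/negP => /(subsetP BT); rewrite !inE eqxx.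
  rewrite -setUA setUCA; apply: fB; last by rewrite cardsU1 iB cB; lia.
  rewrite subUset sub1set Ti; apply: subset_trans BT _; exact: subsetDl.
have -> : star_gens x (i |: A) (T :\ i) (#|T| - p).+1 =
  (star_gens x A (T :\ i) (#|T| - p).+1 `|` [set x i])%classic.
  apply/seteqP; split=> g.
    case=> [[j /= /setU1P[->|Aj] <-]|gD]; [by right|left|by left; right].
    by left; exists j.
  case=> [[[j /= Aj <-]|gD]|->]; [left|by right|left].
    by exists j => //=; rewrite !inE Aj orbT.
  by exists i => //=; rewrite !inE eqxx.
rewrite ideal_genU1 => -[g fg].
have {}fg : ideal_gen (star_gens x A T (#|T| - p).+1) (f - g * x i).
  move: fg; apply: ideal_gen_sub; first exact: ideal_genP.
  move=> h [Ah|[D [DT cD] <-]]; apply: ideal_gen_mem; [by left|right].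
  exists D => //; split=> //; apply: subset_trans DT _; exact: subsetDl.
have gB B : B \subset T :\ i -> #|B| = p -> gen x (A :|: B) g.
  move=> BT cB.
  have iB : i \notin B by apply/negP => /(subsetP BT); rewrite !inE eqxx.
  have BT' : B \subset T by apply: subset_trans BT _; exact: subsetDl.
  apply: (reg (A :|: B) i); last first.
  - rewrite -[g * x i](subKr f); apply: (idealB (gen_ideal _ _)).
      exact: fB.
    move: fg; apply: ideal_gen_sub; first exact: gen_ideal.
    move=> h [[j /= Aj <-]|[D [DT cD] <-]].
      by apply: gen_mem; rewrite inE Aj.
    have /set0Pn[j] : D :&: B != set0.
      apply/eqP => DB0; have : (#|D :|: B| <= #|T|)%N.
        by apply: subset_leq_card; rewrite subUset DT.
      by rewrite cardsU DB0 cards0 cD cB; lia.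
    rewrite inE => /andP[Dj Bj]; rewrite (bigD1 j) //=.
    apply: (idealMr (gen_ideal _ _)).
    by apply: gen_mem; rewrite inE Bj orbT.
  - by rewrite inE negb_or iA iB.
  - by apply: leq_trans (leq_card_setU _ _) _; rewrite cB.
have := IHk A (T :\ i) p g _ dAT' Apc _ gB.
have [] : (#|T :\ i| < k)%N /\ (p <= #|T :\ i|)%N by lia.
move=> -> -> /(_ isT isT) Sg.
rewrite -[f](subrK (g * x i)); apply: (idealD (ideal_genP _)) => //.
suff : colon (ideal_gen (star_gens x A T (#|T| - p).+1)) (x i) g by [].
move: Sg; apply: ideal_gen_sub; first exact/colonP/ideal_genP.
rewrite /colon => h [[j /= Aj <-]|[D [DT cD] <-]] /=.
  apply: (idealMr (ideal_genP _)).
  by apply: ideal_gen_mem; left; exists j.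
have iD : i \notin D by apply/negP => /(subsetP DT); rewrite !inE eqxx.
apply: ideal_gen_mem; right; exists (i |: D) => /=; last first.
  by rewrite big_setU1 //= mulrC.
split; last by rewrite cardsU1 iD cD cT; move: ltpT; rewrite cT; clear; lia.
rewrite subUset sub1set Ti; apply: subset_trans DT _; exact: subsetDl.
Qed.

End RegularFamily.

(** * Exponents of the minimal generators *)

Section Exponents.
Variables (s e : nat).
Local Notation expo := {ffun 'I_s -> nat}.
Implicit Types (a b : expo) (A B D X : {set 'I_s}) (m t : nat).

(** Index sets are constrained through the cardinal [e] of their complement, so
    that the number of indices outside them stays visible. *)
Definition star_exponent m a :=
  forall A, #|~: A| = e -> (m <= \sum_(j in A) a j)%N.

(** With [c = #|X| - e], these are the minimal [a] supported in [X] whose sum is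
    at least [m] on every [c]-subset of [X]: if [t] is the maximum of [a], the
    [e] largest entries equal [t], the [c] smallest ones have sum exactly [m],
    and one of the latter is again [t]. *)
Definition min_exponent X m a := exists t,
  [/\ forall j, (a j <= t)%N, forall j, j \notin X -> a j = 0%N,
      (\sum_j a j = m + e * t)%N & (e < #|[set j in X | a j == t]|)%N].

Definition indicator D : expo := [ffun j => (j \in D : nat)].
Definition expo_add a b : expo := [ffun j => (a j + b j)%N].

Lemma sum_setC_split a A :
  (\sum_j a j = \sum_(j in A) a j + \sum_(j in ~: A) a j)%N.
Proof.
rewrite (bigID (mem A)) /=; congr addn.
by apply: eq_bigl => j; rewrite inE.
Qed.

Lemma sum_indicator D A : (\sum_(j in A) indicator D j = #|A :&: D|)%N.
Proof.
rewrite -sum1_card (big_setID D) /= [X in (_ + X)%N]big1 ?addn0.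
  by apply: eq_bigr => j; rewrite ffunE inE => /andP[_ ->].
by move=> j; rewrite ffunE inE => /andP[/negPf ->].
Qed.

Lemma sum_setC_bound a A t : #|~: A| = e -> (forall j, (a j <= t)%N) ->
  (\sum_(j in ~: A) a j <= e * t)%N.
Proof.
by move=> cA at_; rewrite -cA -sum_nat_const; apply: leq_sum => j _.
Qed.

Lemma min_exponent_star X m a : min_exponent X m a -> star_exponent m a.
Proof.
move=> [t [at_ _ sa _]] A cA; have := sum_setC_bound cA at_.
by move: sa; rewrite (sum_setC_split a A); lia.
Qed.

Lemma sum_setC_tight a A t : #|~: A| = e ->
  (forall j, (a j <= t)%N) -> (e * t <= \sum_(j in ~: A) a j)%N ->
  forall j, j \notin A -> a j = t.
Proof.
move=> cA at_ le_t j jA; apply/eqP; rewrite eqn_leq at_ /= leqNgt.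
apply/negP => lt_t; move: le_t; rewrite leqNgt => /negP; apply.
have jA' : j \in ~: A by rewrite inE.
rewrite -cA -sum_nat_const (bigD1 j) //= [X in (_ < X)%N](bigD1 j) //=.
by rewrite -addSn leq_add // leq_sum.
Qed.

Lemma min_exponent_meets X m a t A : #|~: A| = e ->
  (e < #|[set j in X | a j == t]|)%N -> exists2 j, j \in A & a j = t.
Proof.
move=> cA ltT; have : ~~ ([set j in X | a j == t] \subset ~: A).
  by apply/negP => /subset_leq_card; rewrite cA leqNgt ltT.
by case/subsetPn=> j; rewrite !inE => /andP[_ /eqP ajt]; rewrite negbK; exists j.
Qed.

Lemma min_exponent_tight X m a A : min_exponent X m a -> #|~: A| = e ->
  (\sum_(j in A) a j = m)%N ->
  exists t, [/\ forall j, (a j <= t)%N, forall j, j \notin A -> a j = t &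
                exists2 j, j \in A & a j = t].
Proof.
move=> [t [at_ aX sa ltT]] cA saA; exists t; split=> //.
  apply: sum_setC_tight => //.
  by move: sa; rewrite (sum_setC_split a A) saA => /addnI ->.
exact: (@min_exponent_meets X m).
Qed.

(** A minimal exponent is constant off [A], equal to its maximum on [A], so its
    restriction to [A] determines it. *)
Lemma min_exponent_inj X m a b A :
  min_exponent X m a -> min_exponent X m b -> #|~: A| = e ->
  (\sum_(j in A) a j = m)%N -> {in A, forall j, (b j <= a j)%N} -> b = a.
Proof.
move=> Ma Mb cA saA ba.
have sbA : (\sum_(j in A) b j = m)%N.
  apply/eqP; rewrite eqn_leq (min_exponent_star Mb cA) andbT -saA.
  exact: leq_sum.
have baA : {in A, b =1 a}.
  move=> j Aj; apply/eqP; rewrite eqn_leq ba //= leqNgt; apply/negP => lt_ba.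
  suff : (\sum_(j in A) b j < \sum_(j in A) a j)%N by rewrite saA sbA ltnn.
  rewrite (bigD1 j) //= [X in (_ < X)%N](bigD1 j) //=.
  by rewrite -addSn leq_add // leq_sum // => i /andP[/ba].
have [t [at_ aNA [i Ai ait]]] := min_exponent_tight Ma cA saA.
have [u [bu bNA [j Aj bju]]] := min_exponent_tight Mb cA sbA.
apply/ffunP=> l; have [/baA //|lA] := boolP (l \in A).
rewrite aNA // bNA //; apply/eqP; rewrite eqn_leq -{1}bju baA // at_ /=.
by rewrite -ait -baA.
Qed.

Definition decr a i : expo := [ffun j => (a j - (j == i))%N].

Lemma sum_decr a i A : (0 < a i)%N -> i \in A ->
  (\sum_(j in A) a j = (\sum_(j in A) decr a i j).+1)%N.
Proof.
move=> ai Ai; rewrite (bigD1 i) //= [X in X.+1](bigD1 i) //= ffunE eqxx.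
rewrite -addSn; congr addn; first by lia.
by apply: eq_bigr => j /andP[_ /negPf ji]; rewrite ffunE ji subn0.
Qed.

Lemma sum_decr_notin a i A : i \notin A ->
  (\sum_(j in A) decr a i j = \sum_(j in A) a j)%N.
Proof.
move=> iA; apply: eq_bigr => j Aj; rewrite ffunE.
by case: eqVneq Aj iA => [-> ->|]; rewrite ?subn0.
Qed.

Lemma exists_cocard : (e <= s)%N -> exists A, #|~: A| = e.
Proof.
move=> le_es; have : (0 < #|[set D : {set 'I_s} | D \subset setT & #|D| == e]|)%N.
  by rewrite cards_draws cardsT card_ord bin_gt0.
case/card_gt0P=> D; rewrite inE => /andP[_ /eqP cD].
by exists (~: D); rewrite setCK.
Qed.

(** Lower the entries of [b] as long as possible.  If no entry can be lowered,
    a maximal entry [b i] is blocked by a set [A] that contains [i] and has sum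
    [m]; exchanging [i] with an index outside [A] shows that the entries
    outside [A] are all equal to [b i]. *)
Lemma star_exponent_min m b : (e < s)%N -> star_exponent m b ->
  exists2 a, min_exponent setT m a & forall j, (a j <= b j)%N.
Proof.
move=> lt_es.
have [k] := ubnP (\sum_j b j)%N; elim: k => // k IHk in b *.
rewrite ltnS => leb sb.
have [[i bi si]|nos] := pselect (exists2 i, (0 < b i)%N & star_exponent m (decr b i)).
  have [|a Ma ab] := IHk (decr b i) _ si.
    have e1 := sum_decr bi (in_setT i); move: leb.
    have e2 (f : expo) : (\sum_j f j = \sum_(j in [set: 'I_s]) f j)%N.
      by apply: eq_bigl => j; rewrite inE.
    by rewrite !e2 e1.
  by exists a => // j; apply: leq_trans (ab j) _; rewrite ffunE leq_subr.
exists b => //.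
pose i0 := Ordinal (leq_ltn_trans (leq0n e) lt_es).
pose i := [arg max_(i > i0) b i].
have bi j : (b j <= b i)%N.
  by rewrite /i; case: arg_maxnP => // l _; exact.
have sT : (\sum_(j in [set: 'I_s]) b j = \sum_j b j)%N.
  by apply: eq_bigl => j; rewrite inE.
have [bi0|bi0] := posnP (b i).
  have b0 j : b j = 0%N by apply/eqP; rewrite -leqn0 -bi0.
  exists 0%N; split=> [j|j||]; rewrite ?b0 ?inE //.
    have [A cA] := exists_cocard (ltnW lt_es).
    rewrite muln0 addn0 big1 //; apply/esym/eqP; rewrite -leqn0.
    by apply: leq_trans (sb _ cA) _; rewrite big1.
  rewrite (_ : [set j in _ | _] = setT) ?cardsT ?card_ord //.
  by apply/setP=> j; rewrite !inE b0 eqxx.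
have [A [cA nA]] :
    exists A, #|~: A| = e /\ ~~ (m <= \sum_(j in A) decr b i j)%N.
  apply: contrapT => nex; apply: nos; exists i => // A cA.
  by apply: contrapT => /negP nA; apply: nex; exists A.
have Ai : i \in A.
  by apply: contraT => iA; move: nA; rewrite sum_decr_notin // sb.
have sA : (\sum_(j in A) b j = m)%N.
  by have := sb A cA; move: nA; rewrite (sum_decr bi0 Ai); lia.
have off j : j \notin A -> b j = b i.
  move=> jA; apply/eqP; rewrite eqn_leq bi /=.
  have cA' : #|~: (j |: A :\ i)| = e.
    rewrite cardsCs setCK cardsU1 !inE (negPf jA) andbF add1n.
    have := cardsD1 i A; rewrite Ai add1n => <-.
    by rewrite -cA [RHS]cardsCs setCK.
  have := sb _ cA'; rewrite big_setU1 ?inE ?(negPf jA) ?andbF //= -sA.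
  by rewrite (big_setD1 i Ai) /= leq_add2r.
exists (b i); split=> //; first by move=> j; rewrite inE.
  rewrite (sum_setC_split b A) sA -cA -sum_nat_const; congr addn.
  by apply: eq_bigr => j; rewrite inE => /off.
rewrite -cA; apply: (@leq_trans #|i |: ~: A|); first by rewrite cardsU1 inE Ai.
apply: subset_leq_card; apply/subsetP=> j; rewrite !inE.
by case/orP=> [/eqP ->|/off ->]; rewrite eqxx.
Qed.

Lemma star_exponent_tightened X m a D : min_exponent X m a ->
  (forall A, #|~: A| = e -> (\sum_(j in A) a j = m)%N -> A :&: D != set0) ->
  star_exponent m.+1 (expo_add a (indicator D)).
Proof.
move=> Ma tD A cA; rewrite (eq_bigr (fun j => a j + indicator D j)%N).
  rewrite big_split /= sum_indicator.
  have := min_exponent_star Ma cA; rewrite leq_eqVlt => /orP[/eqP saA|lt_m].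
    by rewrite -addn1 leq_add ?saA // card_gt0 tD.
  exact: leq_trans lt_m (leq_addr _ _).
by move=> j _; rewrite ffunE.
Qed.

(** These are the sums of [m] indicators of [e.+1]-sets, described without
    mentioning a decomposition. *)
Definition power_exponent m b :=
  (forall j, (b j <= m)%N) /\ (\sum_j b j = m * e.+1)%N.

Lemma power_exponent_star m b : power_exponent m b -> star_exponent m b.
Proof.
move=> [bm sb] A cA; have := sum_setC_bound cA bm.
by move: sb; rewrite (sum_setC_split b A) mulnS (mulnC e); lia.
Qed.

Lemma power_exponent_indicator D : #|D| = e.+1 -> power_exponent 1 (indicator D).
Proof.
move=> cD; split=> [j|]; first by rewrite ffunE leq_b1.
rewrite mul1n -cD -[in RHS](setTI D) -sum_indicator.
by apply: eq_bigl => j; rewrite inE.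
Qed.

Lemma power_exponentD m n a b : power_exponent m a -> power_exponent n b ->
  power_exponent (m + n) (expo_add a b).
Proof.
move=> [am sa] [bn sb]; split=> [j|]; first by rewrite ffunE leq_add.
rewrite mulnDl -sa -sb -big_split /=; apply: eq_bigr => j _.
by rewrite ffunE.
Qed.

Definition pure_exponent m D : expo := [ffun j => (m * (j \in D))%N].

(** Comparing the two formulas for the sum of [b] gives [e * t = e * m], so the
    maximum is [m], and it is attained on at least [e.+1] indices, which already
    account for the whole sum. *)
Lemma power_exponent_min m b : (e < s)%N -> (0 < e)%N ->
  power_exponent m b -> min_exponent setT m b ->
  exists2 D : {set 'I_s}, #|D| = e.+1 & b = pure_exponent m D.
Proof.
move=> lt_es e0 [bm sb] [t [bt _ sb' ltT]].
have etm : t = m.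
  apply/eqP; rewrite -(eqn_pmul2l e0); apply/eqP.
  by move: sb' sb; rewrite mulnS (mulnC e m) => ->; lia.
rewrite {}etm {t} in bt sb' ltT.
set D := [set j in _ | _] in ltT.
have sD : (\sum_(j in D) b j = m * #|D|)%N.
  rewrite mulnC -sum_nat_const; apply: eq_bigr => j.
  by rewrite inE => /andP[_ /eqP].
have := sum_setC_split b D; rewrite sb sD => sD'.
(* If m = 0 then b = 0, and any D with e + 1 elements will do. *)
have [m0|m0] := posnP m.
  have /card_gt0P[D'] : (0 < #|[set D : {set 'I_s} | D \subset setT & #|D| == e.+1]|)%N.
    by rewrite cards_draws cardsT card_ord bin_gt0.
  rewrite inE => /andP[_ /eqP cD']; exists D' => //.
  by apply/ffunP=> j; rewrite ffunE m0; apply/eqP; rewrite -leqn0 -m0.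
have cD : #|D| = e.+1.
  by apply/eqP; rewrite eqn_leq ltT andbT -(leq_pmul2l m0) sD' leq_addr.
exists D => //; apply/ffunP=> j; rewrite ffunE.
have [|jD] := boolP (j \in D); first by rewrite !inE muln1 => /eqP.
move/eqP: sD'; rewrite cD -[X in X == _]addn0 eqn_add2l eq_sym sum_nat_eq0.
by move/forallP/(_ j); rewrite inE jD muln0 => /eqP.
Qed.

Lemma pure_exponent_min m D : #|D| = e.+1 ->
  min_exponent setT m (pure_exponent m D).
Proof.
move=> cD; exists m; split=> [j|j||].
- by rewrite ffunE; case: (_ \in _); lia.
- by rewrite inE.
- rewrite (eq_bigr (fun j => m * indicator D j)%N) => [|j _]; last by rewrite !ffunE.
  rewrite -big_distrr /=.
  by have [_ ->] := power_exponent_indicator cD; rewrite mul1n mulnS mulnC.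
- rewrite -ltnS -cD ltnS; apply: subset_leq_card.
  by apply/subsetP=> j Dj; rewrite !inE ffunE Dj muln1 eqxx.
Qed.

Lemma pure_exponent_inj m : (0 < m)%N -> injective (pure_exponent m).
Proof.
move=> m0 D D' /ffunP eqD; apply/setP=> j; have := eqD j; rewrite !ffunE.
by move/eqP; rewrite eqn_pmul2l //; do 2 case: (_ \in _).
Qed.

End Exponents.

(** * Ideals generated by monomials in a regular family *)

Lemma ideal_gen_mul (R : comNzRingType) (S S' K : set R) (f g : R) :
  is_ideal K -> (forall f g, S f -> S' g -> K (f * g)) ->
  ideal_gen S f -> ideal_gen S' g -> K (f * g).
Proof.
move=> idK SK Sf Sg; suff : colon K g f by [].
move: Sf; apply: ideal_gen_sub; first exact: colonP.
move=> h Sh; rewrite /colon /= mulrC; suff : colon K h g by [].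
move: Sg; apply: ideal_gen_sub; first exact: colonP.
by move=> l Sl; rewrite /colon /= mulrC; apply: SK.
Qed.

(** An induction principle for powers of an ideal: it bounds them by any family
    of ideals that is compatible with multiplication by elements of [J]. *)
Lemma ideal_exp_sub (R : comNzRingType) (J : set R) (K : nat -> set R) m :
  (forall n, is_ideal (K n)) -> K 0%N 1 ->
  (forall n f g, J f -> K n g -> K n.+1 (f * g)) ->
  forall f, ideal_exp J m f -> K m f.
Proof.
move=> idK K0 JK; apply: ideal_gen_sub => // _ [h Jh <-].
elim: m h Jh => [|m IHm] h Jh; first by rewrite big_ord0.
rewrite big_ord_recl; apply: JK; first exact: Jh.
by apply: IHm => i; exact: Jh.
Qed.

Lemma ideal_gen_seqP (R : comNzRingType) (I : eqType) (M : seq I)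
    (F : I -> R) (f : R) : uniq M ->
  ideal_gen [set F i | i in [set` M]] f ->
  exists r : I -> R, f = \sum_(i <- M) r i * F i.
Proof.
move=> uM; pose J : set R :=
  [set f | exists r : I -> R, f = \sum_(i <- M) r i * F i]%classic.
apply: (@ideal_gen_sub _ _ J); first split.
- by exists (fun=> 0); rewrite big1 // => i _; rewrite mul0r.
- move=> _ _ [p ->] [q ->]; exists (fun i => p i + q i).
  by rewrite -big_split; apply: eq_bigr => i _; rewrite mulrDl.
- move=> a _ [p ->]; exists (fun i => a * p i).
  by rewrite big_distrr; apply: eq_bigr => i _; rewrite /= mulrA.
- move=> _ [i /= Mi <-]; exists (fun l => (l == i)%:R).
  rewrite (bigD1_seq i) //= eqxx mul1r big1 ?addr0 // => l /negPf ->.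
  by rewrite mul0r.
Qed.

Section StarMonomials.
Variables (R : comNzRingType) (s c e : nat) (x : 'I_s -> R).
Hypothesis ce_s : (c + e = s)%N.
Hypothesis reg : regular_family x c.
Local Notation expo := {ffun 'I_s -> nat}.
Implicit Types (a b : expo) (A B D T : {set 'I_s}) (f g : R).

Lemma cocardE A : (#|~: A| = e) <-> (#|A| = c).
Proof. by have := cardsC A; rewrite card_ord; lia. Qed.

Definition mon a : R := \prod_j x j ^+ a j.

Lemma monD a b : mon (expo_add a b) = mon a * mon b.
Proof.
by rewrite -big_split; apply: eq_bigr => j _; rewrite ffunE exprD.
Qed.

Lemma mon_indicator D : mon (indicator D) = \prod_(j in D) x j.
Proof.
rewrite [RHS]big_mkcond; apply: eq_bigr => j _; rewrite ffunE.
by case: (j \in D).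
Qed.

Lemma mon_le a b : (forall j, (a j <= b j)%N) -> exists g, mon b = g * mon a.
Proof.
move=> ab; exists (mon [ffun j => (b j - a j)%N]); rewrite -monD.
by congr mon; apply/ffunP=> j; rewrite !ffunE subnK.
Qed.

Lemma mon_split A a :
  mon a = (\prod_(j in ~: A) x j ^+ a j) * (\prod_(j in A) x j ^+ a j).
Proof.
rewrite /mon (bigID (mem A)) /= mulrC; congr (_ * _).
by apply: eq_bigl => j; rewrite inE.
Qed.

Definition star_monomials m : set R :=
  ideal_gen [set mon a | a in [set a | star_exponent e m a]].

Lemma star_monomials_mem m a : star_exponent e m a -> star_monomials m (mon a).
Proof. by move=> sa; apply: ideal_gen_mem; exists a. Qed.

Lemma star_monomialsP m : is_ideal (star_monomials m).
Proof. exact: ideal_genP. Qed.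

Lemma star_monomials_span m (M : seq expo) : (e < s)%N -> uniq M ->
  (forall a, a \in M <-> min_exponent e setT m a) ->
  forall f, star_monomials m f ->
  exists r : expo -> R, f = \sum_(a <- M) r a * mon a.
Proof.
move=> lt_es uM ME f Lf; apply: ideal_gen_seqP => //; move: Lf.
apply: ideal_gen_sub; first exact: ideal_genP.
move=> _ [b sb <-]; have [a Ma ab] := star_exponent_min lt_es sb.
have [g ->] := mon_le ab; apply: (idealM (ideal_genP _)).
by apply: ideal_gen_mem; exists a => //=; apply/ME.
Qed.

Lemma mon_pure m D : mon (pure_exponent m D) = (\prod_(j in D) x j) ^+ m.
Proof.
rewrite -prodrXl [RHS]big_mkcond; apply: eq_bigr => j _; rewrite ffunE.
by case: (j \in D); rewrite ?muln1 ?muln0.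
Qed.

Lemma mon_mem_powers a b A : (exists2 j, j \in A & (a j < b j)%N) ->
  gen (fun j => x j ^+ (a j).+1) A (mon b).
Proof.
move=> [j Aj ab]; rewrite (mon_split A) (bigD1 j Aj) /= mulrA mulrAC.
apply: (idealM (gen_ideal _ _)); rewrite -(subnK ab) exprD.
apply: (idealM (gen_ideal _ _)).
exact: (@gen_mem _ _ (fun j => x j ^+ (a j).+1) _ _ Aj).
Qed.

(** All the terms other than [r a * mon a] lie in the ideal [N] of the powers
    [x j ^+ (a j).+1], [j] in [A]: an exponent whose sum on [A] is at least [m]
    and that is bounded by [a] on [A] coincides with [a] there, hence
    everywhere.  Modulo [N] the variables outside [A] cancel, and then
    [regular_family_colon] applies. *)
Lemma star_syzygy m (M : seq expo) (r : expo -> R) a A :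
  uniq M -> {in M, forall b, min_exponent e setT m b} ->
  star_monomials m.+1 (\sum_(b <- M) r b * mon b) ->
  a \in M -> #|A| = c -> (\sum_(j in A) a j = m)%N -> gen x A (r a).
Proof.
move=> uM Mmin Lf Ma /cocardE cA saA.
set N := gen (fun j => x j ^+ (a j).+1) A.
have idN : is_ideal N by exact: gen_ideal.
have N1 f : star_monomials m.+1 f -> N f.
  apply: ideal_gen_sub => // _ [b /(_ A cA) sb <-]; apply: mon_mem_powers.
  apply: contrapT => nab; move: sb; rewrite -{}saA ltnNge => /negP; apply.
  apply: leq_sum => j Aj; rewrite leqNgt; apply/negP => lt_ab.
  by apply: nab; exists j.
have {Lf N1}/N1 := Lf; rewrite (bigD1_seq a) //= => Na.
have {}Na : N (r a * mon a).
  rewrite -[_ * _](addrK (\sum_(b <- M | b != a) r b * mon b)).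
  apply: (idealB idN) => //; rewrite big_seq_cond; apply: ideal_sum => //.
  move=> b /andP[Mb ba]; apply: (idealM idN); apply: mon_mem_powers.
  apply: contrapT => nab; move/eqP: ba; apply.
  apply: min_exponent_inj (Mmin _ Ma) (Mmin _ Mb) cA saA _ => j Aj.
  by rewrite leqNgt; apply/negP => lt_ab; apply: nab; exists j.
have cA' : (#|A| <= c)%N by rewrite (cocardE A).1.
apply: (regular_family_colon reg cA' (n := a)); move: Na.
rewrite (mon_split A) mulrA mulrAC; apply: nonzerodivisor_prod => j.
rewrite inE => jA; apply: nonzerodivisorX.
exact: (regular_family_powers reg).
Qed.

(** Let [T] be the set where [a] takes its maximal value.  The [c]-sets on which
    [a] has sum [m] are those that contain [~: T], so [r] is a combination of
    the elements supplied by [star_intersection]; each of them is a squarefree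
    monomial whose support meets all these sets. *)
Lemma star_tight_mul m a r : min_exponent e setT m a ->
  (forall A, #|A| = c -> (\sum_(j in A) a j = m)%N -> gen x A r) ->
  star_monomials m.+1 (r * mon a).
Proof.
move=> Ma rA; have [t [at_ _ sa ltT]] := Ma.
set T := [set j in setT | a j == t] in ltT.
have cT : (#|~: T| + #|T| = c + e)%N by rewrite addnC cardsC card_ord ce_s.
have tight A : #|~: A| = e -> (\sum_(j in A) a j = m)%N -> ~: T \subset A.
  move=> cA saA; apply/subsetP=> j; rewrite !inE; apply: contraR => jA.
  suff -> : a j = t by rewrite eqxx.
  apply: (sum_setC_tight cA at_) => //.
  by move: sa; rewrite (sum_setC_split a A) saA => /addnI ->.
have : ideal_gen (star_gens x (~: T) T (#|T| - (c - #|~: T|)).+1) r.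
  have ltTc : (#|~: T| < c)%N by rewrite -(ltn_add2r #|T|) cT ltn_add2l.
  apply: star_intersection reg _ _ _ _.
  - by rewrite disjoint_sym disjoints_subset setCK.
  - by rewrite subnKC // ltnW.
  - by rewrite leq_subLR cT leq_addr.
  move=> B BT cB.
  have cTB : #|~: T :|: B| = c.
    rewrite cardsU (_ : ~: T :&: B = set0) ?cards0; first by rewrite cB; lia.
    apply/setP=> j; rewrite !inE; have [/(subsetP BT)|] := boolP (j \in B).
      by rewrite !inE => /= ->.
    by rewrite andbF.
  apply: rA => //; apply/eqP; rewrite -(eqn_add2r (e * t)) -sa.
  rewrite (sum_setC_split a (~: T :|: B)) eqn_add2l eq_sym.
  rewrite -((cocardE _).2 cTB) -sum_nat_const; apply/eqP/eq_bigr => j.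
  by rewrite !inE negb_or negbK => /andP[/eqP].
suff H D : (forall A, #|~: A| = e -> (\sum_(j in A) a j = m)%N ->
    A :&: D != set0) -> star_monomials m.+1 (\prod_(j in D) x j * mon a).
  move=> Sr; suff : colon (star_monomials m.+1) (mon a) r by [].
  move: Sr; apply: ideal_gen_sub; first exact/colonP/star_monomialsP.
  move=> h [[j /= Tj <-]|[D [DT cD] <-]]; rewrite /colon /=.
    rewrite -(big_set1 *%R j x); apply: H => A cA /tight -/(_ cA) /subsetP TA.
    by apply/set0Pn; exists j; rewrite !inE eqxx andbT TA.
  apply: H => A cA /tight -/(_ cA) TA; apply/eqP => AD0.
  have : (#|A :|: D| <= s)%N by rewrite -[X in (_ <= X)%N]card_ord max_card.
  have := cardsUI A D; rewrite AD0 cards0 cD.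
  have := (cocardE A).1 cA.
  have : (#|~: A :|: D| <= #|T|)%N.
    by rewrite subset_leq_card // subUset DT andbT -[T]setCK setCS.
  have := cardsU (~: A) D.
  rewrite (_ : ~: A :&: D = D); first by rewrite cA cD; lia.
  apply/setIidPr; apply/subsetP=> j Dj; rewrite inE; apply/negP => Aj.
  by have : j \in A :&: D; [rewrite inE Aj|rewrite AD0 inE].
move=> tD; rewrite -mon_indicator mulrC -monD; apply: star_monomials_mem.
exact: star_exponent_tightened Ma tD.
Qed.

Definition power_monomials m : set R :=
  ideal_gen [set mon b | b in [set b | power_exponent e m b]].

(** This is [star_intersection] for the family of all [c]-sets. *)
Lemma star_ideal_monomials f : star_ideal c x f -> power_monomials 1 f.
Proof.
move=> If; have : ideal_gen (star_gens x set0 setT (#|[set: 'I_s]| - c).+1) f.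
  apply: star_intersection reg _ _ _ _.
  - by rewrite disjoints_subset sub0set.
  - by rewrite cards0.
  - by rewrite cardsT card_ord -ce_s leq_addr.
  - by move=> B _ cB; rewrite set0U; apply: If.
apply: ideal_gen_sub; first exact: ideal_genP.
move=> h [[j /=]|[D [_ cD] <-]]; first by rewrite inE.
apply: ideal_gen_mem; exists (indicator D); last exact: mon_indicator.
by apply: power_exponent_indicator; rewrite cD cardsT card_ord -ce_s addKn.
Qed.

Lemma star_ideal_mem D : #|D| = e.+1 -> star_ideal c x (\prod_(j in D) x j).
Proof.
move=> cD A /= cA; have /set0Pn[j] : A :&: D != set0.
  apply/eqP => AD0; have := cardsUI A D; rewrite AD0 cards0 cD cA.
  have : (#|A :|: D| <= s)%N by rewrite -[X in (_ <= X)%N]card_ord max_card.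
  by lia.
rewrite inE => /andP[Aj Dj]; rewrite (bigD1 j) //=.
by apply: (idealMr (gen_ideal _ _)); apply: gen_mem.
Qed.

Lemma power_star_monomials m f : power_monomials m f -> star_monomials m f.
Proof.
apply: ideal_gen_sub; first exact: star_monomialsP.
by move=> _ [b pb <-]; apply: star_monomials_mem; exact: power_exponent_star.
Qed.

Lemma star_ideal_exp_monomials m f :
  ideal_exp (star_ideal c x) m f -> power_monomials m f.
Proof.
apply: ideal_exp_sub => [n||n {}f g /star_ideal_monomials If Jg].
- exact: ideal_genP.
- apply: ideal_gen_mem; exists [ffun=> 0%N].
    split=> [j|]; first by rewrite ffunE.
    by rewrite mul0n big1 // => j _; rewrite ffunE.
  by rewrite /mon big1 // => j _; rewrite ffunE.
- apply: ideal_gen_mul If Jg; first exact: ideal_genP.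
  move=> _ _ [a pa <-] [b pb <-]; rewrite -monD; apply: ideal_gen_mem.
  by exists (expo_add a b) => //=; rewrite -add1n; apply: power_exponentD.
Qed.

Lemma pure_ideal_exp m D : #|D| = e.+1 ->
  ideal_exp (star_ideal c x) m (mon (pure_exponent m D)).
Proof.
move=> cD; rewrite mon_pure; apply: ideal_gen_mem.
exists (fun=> \prod_(j in D) x j); last by rewrite prodr_const card_ord.
by move=> i; apply: star_ideal_mem.
Qed.

End StarMonomials.

(** * Noetherianity of polynomial rings *)

Lemma nondecreasing_subsequence (u : nat -> nat) :
  exists phi : nat -> nat, {homo phi : i j / (i < j)%N} /\
    {homo u \o phi : i j / (i <= j)%N}.
Proof.
have tail_min N : exists i, (N <= i)%N /\ forall j, (N <= j)%N -> (u i <= u j)%N.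
  have ex : exists v, `[< exists2 i, (N <= i)%N & u i = v >].
    by exists (u N); apply/asboolP; exists N.
  case: (ex_minnP ex) => v /asboolP[i Ni <-] vmin; exists i; split=> // j Nj.
  by apply: vmin; apply/asboolP; exists j.
have [h hP] := choice tail_min.
pose phi := fix phi i := if i is i'.+1 then h (phi i').+1 else h 0%N.
exists phi; have phiS i : (phi i < phi i.+1)%N by exact: (hP _).1.
split; first exact: (homo_ltn (@ltn_trans)).
apply: (homo_leq (@leqnn) (@leq_trans)) => i.
case: i => [|i]; first exact: (hP 0%N).2.
by apply: (hP (phi i).+1).2; exact: ltn_trans (phiS i) (phiS i.+1).
Qed.

(** Extract successively a subsequence that is nondecreasing in each
    coordinate. *)
Lemma dickson n (f : nat -> 'X_{1..n}) :
  exists i j, (i < j)%N /\ (f i <= f j)%MM.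
Proof.
suff [phi [incr mono]] : exists phi : nat -> nat,
    {homo phi : i j / (i < j)%N} /\
    forall l : 'I_n, l \in enum 'I_n -> {homo (fun i => f (phi i) l) : i j / (i <= j)%N}.
  exists (phi 0%N), (phi 1%N); split; first exact: incr.
  by apply/mnm_lepP => l; apply: (mono l _ 0%N 1%N) => //; rewrite mem_enum.
elim: (enum 'I_n) => [|l ls [phi [incr mono]]].
  by exists id; split=> // l; rewrite in_nil.
have [psi [incr' mono']] := nondecreasing_subsequence (fun i => f (phi i) l).
exists (phi \o psi); split=> [i j ij|l']; first exact: incr (incr' _ _ ij).
rewrite inE => /orP[/eqP ->|l'ls] i j ij; first exact: (mono' i j).
by apply: mono => //; exact: ltnW_homo.
Qed.

Definition noetherian (R : comNzRingType) := forall J : nat -> set R,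
  (forall i, is_ideal (J i)) -> (forall i f, J i f -> J i.+1 f) ->
  exists i, forall f, J i.+1 f -> J i f.

(** In a strictly increasing chain, choose in each [J i.+1] outside [J i] an
    element with minimal leading monomial.  By Dickson's lemma the leading
    monomial of one of them divides that of a later one; cancelling the leading
    term of the latter contradicts its minimality. *)
Lemma mpoly_noetherian (k : fieldType) n : noetherian {mpoly k[n]}.
Proof.
move=> J idJ Jsub; apply: contrapT => nstab.
have Jle i j f : (i <= j)%N -> J i f -> J j f.
  move=> /subnK <-; elim: (j - i)%N => // l IHl Ji; rewrite addSn.
  by apply: Jsub; exact: IHl.
have new i : exists f, [/\ J i.+1 f, ~ J i f &
    forall g, J i.+1 g -> ~ J i g -> ~~ (mlead g < mlead f)%O].
  apply: contrapT => nomin; apply: nstab; exists i => f Jf.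
  apply: contrapT => nJf.
  elim/(well_founded_induction (@ltom_wf n)): (mlead f) {-2}f (erefl (mlead f)) Jf nJf.
  move=> mu IH {}f mf Jf nJf; apply: nomin; exists f; split=> // g Jg nJg.
  by apply/negP; rewrite mf => lt_gf; exact: IH lt_gf _ erefl Jg nJg.
have [F FP] := choice new.
have [i [j [ij le_ij]]] := dickson (fun i => mlead (F i)).
have [Ji nJi _] := FP i; have [Jj nJj minj] := FP j.
have Fi0 : mleadc (F i) != 0.
  by rewrite mleadc_eq0; apply/eqP => F0; apply: nJi; rewrite F0; exact: ideal0.
set h := (mleadc (F j) / mleadc (F i))%:MP * 'X_[(mlead (F j) - mlead (F i))].
have Jh : J j (h * F i) by apply: idealM => //; exact: Jle Ji.
have nJq : ~ J j (F j - h * F i).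
  by move=> Jq; apply: nJj; rewrite -[F j](subrK (h * F i)); exact: idealD.
have Jq : J j.+1 (F j - h * F i) by apply: idealB => //; exact: Jsub.
have := minj _ Jq nJq; apply/negP; rewrite negbK.
have q0 : F j - h * F i != 0.
  by apply/eqP => q0; apply: nJq; rewrite q0; exact: ideal0.
have hF : h * F i = (mleadc (F j) / mleadc (F i)) *:
    ('X_[(mlead (F j) - mlead (F i))] * F i).
  by rewrite /h -mulrA mul_mpolyC.
rewrite lt_neqAle; apply/andP; split; last first.
  apply: (le_trans (mleadB_le _ _)).
  rewrite leUx lexx /= hF.
  apply: (le_trans (mleadZ_le _ _)).
  apply: (le_trans (mleadM_le _ _)).
  by rewrite mleadXm submK // lexx.
apply/eqP => eq_lead; move/negP: q0; apply; rewrite -mleadc_eq0 eq_lead.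
have lcX : ('X_[(mlead (F j) - mlead (F i))] * F i)@_(mlead (F j)) = mleadc (F i).
  by rewrite mulrC -[X in _@_X](submK le_ij) mcoeffMX.
by rewrite mcoeffB hF mcoeffZ lcX divfK // subrr.
Qed.

(** * Associated primes and symbolic powers *)

Lemma regular_sequences_family (R : comNzRingType) (s c : nat) (x : 'I_s -> R) :
  (c < s)%N ->
  (forall sigma : 'I_c.+1 -> 'I_s, injective sigma ->
     regular_sequence (fun i : 'I_c.+1 => x (sigma i))) ->
  regular_family x c.
Proof.
move=> lt_cs xreg A j Ac jA f.
(* Order the indices so that those of A come first and j comes next. *)
pose l := enum A ++ j :: enum (~: (j |: A)).
have ul : uniq l.
  rewrite cat_uniq /= !enum_uniq !mem_enum !inE eqxx /= andbT.
  rewrite negb_or jA /=; apply/hasPn => i.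
  by rewrite !mem_enum !inE negb_or => /andP[].
have sl : size l = s.
  rewrite size_cat /= -!cardE addnS -addSn -add1n.
  by have := cardsC (j |: A); rewrite cardsU1 jA card_ord.
pose sigma (i : 'I_c.+1) := nth j l i.
have sigma_inj : injective sigma.
  move=> i i' /eqP; rewrite nth_uniq ?sl //; last 2 first.
  - exact: leq_trans (ltn_ord i) lt_cs.
  - exact: leq_trans (ltn_ord i') lt_cs.
  by move/eqP/val_inj.
have [+ _] := xreg _ sigma_inj; have Ac' : (#|A| < c.+1)%N by [].
move=> /(_ (Ordinal Ac')) /= /(_ f).
rewrite {2}/sigma nth_cat -cardE ltnn subnn /=.
suff -> : ideal_gen [set x (sigma i) | i in [set i : 'I_c.+1 | (i < #|A|)%N]]%classic
  = gen x A by [].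
congr ideal_gen; apply/seteqP; split=> g [i /= Hi <-].
  exists (sigma i) => //=; rewrite /sigma nth_cat -cardE Hi.
  by rewrite -mem_enum mem_nth // -cardE.
have iA : (index i (enum A) < #|A|)%N by rewrite cardE index_mem mem_enum.
exists (Ordinal (ltn_trans iA Ac')) => //=.
by rewrite /sigma /= nth_cat -cardE iA nth_index // mem_enum.
Qed.

(** If [a b] kills [d y] modulo [K] but neither [a] nor [b] does, then the
    annihilator of [b d y] contains that of [d y], and also [a]; repeating this
    would give a strictly increasing chain of ideals. *)
Lemma exists_associated_prime (R : comNzRingType) (K : set R) (y : R) :
  noetherian R -> is_ideal K -> ~ K y ->
  exists d, is_prime_ideal (colon K (d * y)).
Proof.
move=> noethR idK nKy; apply: contrapT => noprime.
have step d : exists d', ~ K (d * y) -> ~ K (d' * y) /\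
    (forall f, colon K (d * y) f -> colon K (d' * y) f) /\
    exists2 f, colon K (d' * y) f & ~ colon K (d * y) f.
  have [Kd|nKd] := pselect (K (d * y)); first by exists d.
  apply: contrapT => stop; apply: noprime; exists d; split.
  - exact: colonP.
  - by rewrite /colon /= mul1r.
  move=> a b Kab; apply: contrapT => nab; apply: stop; exists (b * d) => _.
  split; [|split].
  - by move=> Kb; apply: nab; right; rewrite /colon /= mulrA.
  - move=> f Kf; rewrite /colon /=.
    have -> : f * (b * d * y) = b * (f * (d * y)) by ring.
    exact: idealM.
  - exists a; last by move=> Ka; apply: nab; left.
    rewrite /colon /=; suff -> : a * (b * d * y) = a * b * (d * y) by [].
    by ring.
have [h hP] := choice step; pose d i := iter i h 1.
have nKd i : ~ K (d i * y).
  by elim: i => [|i IHi]; [rewrite mul1r|exact: (hP _ IHi).1].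
have [] := noethR (fun i => colon K (d i * y)).
- by move=> i; exact: colonP.
- by move=> i f; exact: (hP _ (nKd i)).2.1.
move=> i stab; have [f /stab] := (hP _ (nKd i)).2.2; exact.
Qed.

Lemma prime_ideal_prod (R : comNzRingType) (P : set R) (I : finType)
    (Q : pred I) (E : I -> R) : is_prime_ideal P ->
  (forall i, Q i -> ~ P (E i)) -> ~ P (\prod_(i | Q i) E i).
Proof.
move=> [_ P1 PM] nPE; apply: (big_ind (fun f => ~ P f)) => // f g nf ng.
by move=> /PM[].
Qed.

(** A common denominator turns membership in [J R_P] into a statement in [R]. *)
Lemma ideal_localizationP (R : idomainType) (J P : set R) (f : R) :
  is_ideal J -> is_prime_ideal P ->
  ideal_localization J P (@FracField.tofrac R f) <->
  exists u, ~ P u /\ J (u * f).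
Proof.
move=> idJ [idP nP1 PM].
have u_neq0 u : ~ P u -> @FracField.tofrac R u != 0.
  move=> nPu; rewrite tofrac_eq0; apply/eqP => u0; apply: nPu.
  by rewrite u0; exact: ideal0.
split=> [[q [a [y [Ja Py fE]]]]|[u [nPu Ju]]]; last first.
  exists 1%N, (fun=> u * f), (fun=> 1 / @FracField.tofrac R u); split=> //.
    by move=> _; exists 1, u; rewrite tofrac1.
  by rewrite big_ord1 tofracM mulrA mulr1 mulrAC divff ?mul1r ?u_neq0.
suff [u [g [nPu Jg ug]]] : exists u g, [/\ ~ P u, J g &
    @FracField.tofrac R u * \sum_(i < q) @FracField.tofrac R (a i) * y i =
    @FracField.tofrac R g].
  exists u; split=> //; move: ug; rewrite -fE -tofracM => /eqP.
  by rewrite tofrac_eq => /eqP ->.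
elim: (index_enum _) => [|i l [u [g [nPu Jg ug]]]].
  exists 1, 0; split=> //; first exact: ideal0.
  by rewrite big_nil mulr0 tofrac0.
have [b [v [nPv yE]]] := Py i.
exists (u * v), (u * (a i * b) + v * g); split.
- by move=> /PM[].
- apply: idealD => //; apply: idealM => //; exact: idealMr.
rewrite big_cons mulrDr yE tofracD !tofracM -ug.
have /u_neq0 := nPv; move: (@FracField.tofrac R v) (@FracField.tofrac R u).
by move=> V U V0; field.
Qed.

Lemma ideal_expS (R : comNzRingType) (J : set R) m f g :
  J f -> ideal_exp J m g -> ideal_exp J m.+1 (f * g).
Proof.
move=> Jf Jg; rewrite mulrC; suff : colon (ideal_exp J m.+1) f g by [].
move: Jg; apply: ideal_gen_sub; first exact/colonP/ideal_genP.
move=> _ [h Jh <-]; apply: ideal_gen_mem.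
exists (fun i => if unlift ord0 i is Some j then h j else f) => [i|].
  by case: (unlift ord0 i).
rewrite big_ord_recl unlift_none mulrC; congr (_ * _).
by apply: eq_bigr => i _; rewrite liftK.
Qed.

Lemma ideal_exp0 (R : comNzRingType) (J : set R) f : ideal_exp J 0 f.
Proof.
rewrite -[f]mulr1; apply: (idealM (ideal_genP _)); apply: ideal_gen_mem.
by exists (fun=> 0); [case|rewrite big_ord0].
Qed.

Lemma ideal_exp_pred (R : comNzRingType) (J : set R) m f :
  ideal_exp J m.+1 f -> ideal_exp J m f.
Proof.
apply: (@ideal_exp_sub _ _ (fun n => ideal_exp J n.-1)) => [n||].
- exact: ideal_genP.
- exact: ideal_exp0.
- by case=> [|n] h g Jh Jg /=; [exact: ideal_exp0|exact: ideal_expS].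
Qed.

Section SymbolicPower.
Variables (R : idomainType) (s c e : nat) (x : 'I_s -> R).
Hypothesis ce_s : (c + e = s)%N.
Hypothesis reg : regular_family x c.
Local Notation expo := {ffun 'I_s -> nat}.
Local Notation I_c := (star_ideal c x).
Implicit Types (a b : expo) (A B D : {set 'I_s}) (f g : R).

Definition prod_outside A := \prod_(j in ~: A) x j.

(** Multiplying any [x i], [i] in [A], by the product of the variables outside
    [A] gives a squarefree monomial of degree [e.+1], which is in [I_c]. *)
Lemma prod_outside_exp A m b : #|A| = c -> (m <= \sum_(j in A) b j)%N ->
  ideal_exp I_c m (prod_outside A ^+ m * \prod_(j in A) x j ^+ b j).
Proof.
move=> cA; elim: m b => [|m IHm] b lt_m; first exact: ideal_exp0.
have [i Ai bi] : exists2 i, i \in A & (0 < b i)%N.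
  apply: contrapT => nob; move: lt_m; rewrite big1 // => i Ai; apply/eqP.
  by rewrite -leqn0 leqNgt; apply/negP => bi; apply: nob; exists i.
have := lt_m; rewrite (sum_decr bi Ai) ltnS => /IHm Im.
have -> : prod_outside A ^+ m.+1 * (\prod_(j in A) x j ^+ b j) =
    (x i * prod_outside A) * (prod_outside A ^+ m * \prod_(j in A) x j ^+ decr b i j).
  rewrite (bigD1 i Ai) [in RHS](bigD1 i Ai) /= ffunE eqxx -(prednK bi) subn1 /=.
  rewrite [X in _ = _ * (_ * (_ * X))](eq_bigr (fun j => x j ^+ b j)).
    by rewrite !exprS; ring.
  by move=> j /andP[_ /negPf ji]; rewrite ffunE ji subn0.
apply: ideal_expS Im; rewrite -big_setU1 ?inE ?Ai //.
apply: (@star_ideal_mem _ _ _ _ _ ce_s); rewrite cardsU1 inE Ai.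
by rewrite ((cocardE ce_s A).2 cA).
Qed.

(** For an associated prime [I_c : y] choose [A] such that [y] is not in
    [(x_i : i in A)].  The variables outside [A] are not in the prime, and a
    power of their product sends the generators into [I_c^m]. *)
Lemma star_monomials_symbolic m f :
  star_monomials e x m f -> symbolic_power I_c m f.
Proof.
move=> Lf P [primeP [y PE]].
have [A [cA nAy]] : exists A, #|A| = c /\ ~ gen x A y.
  apply: contrapT => Iy; have [_ + _] := primeP; apply; rewrite PE /= mul1r.
  by move=> A cA; apply: contrapT => nAy; apply: Iy; exists A.
apply/ideal_localizationP => //; first exact: ideal_genP.
exists (prod_outside A ^+ m); split.
  have nP : ~ P (prod_outside A).
    apply: prime_ideal_prod => // j; rewrite inE => jA Pj; apply: nAy.
    apply: (reg _ jA); first by rewrite cA.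
    by rewrite mulrC; move: Pj; rewrite PE => /(_ A cA).
  have [_ nP1 PM] := primeP.
  by elim: m {Lf} => [|m IHm]; rewrite ?expr0 // exprS => /PM[].
rewrite mulrC; suff : colon (ideal_exp I_c m) (prod_outside A ^+ m) f by [].
move: Lf; apply: ideal_gen_sub; first exact/colonP/ideal_genP.
move=> _ [b sb <-]; rewrite /colon /= (mon_split x A) mulrC mulrCA mulrA.
rewrite -mulrA; apply: (idealM (ideal_genP _)); apply: prod_outside_exp => //.
by apply: sb; apply/(cocardE ce_s).
Qed.

(** The prime is also the annihilator of [y] times the variables outside [A]
    modulo [I_c]: this product lies in the ideals of all the other [c]-sets, and
    the added variables are nonzerodivisors modulo that of [A]. *)
Lemma colon_associated A y : #|A| = c -> is_prime_ideal (colon (gen x A) y) ->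
  associated_primes I_c (colon (gen x A) y).
Proof.
move=> cA primeP; split=> //; exists (y * prod_outside A).
apply/seteqP; split=> f; rewrite /colon /= mulrA; last first.
  move=> /(_ A cA); apply: nonzerodivisor_prod => j; rewrite inE => jA.
  by apply: reg; rewrite ?cA.
move=> Af B cB; have [->|BA] := eqVneq B A.
  by apply: (idealMr (gen_ideal _ _)).
have /subsetPn[j Bj jA] : ~~ (B \subset A).
  by apply: contra BA => BA; rewrite eqEcard BA cA cB leqnn.
rewrite /prod_outside (bigD1 j) ?inE //=.
apply: (idealM (gen_ideal _ _)); apply: (idealMr (gen_ideal _ _)).
exact: gen_mem.
Qed.

(** Induction on [m]: the coefficients of [f] over the minimal generators of the
    ideal for [m] lie in all the ideals required by [star_tight_mul], since
    otherwise localizing at an associated prime contradicts [star_syzygy]. *)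
Lemma symbolic_star_monomials m f : noetherian R -> (0 < c)%N ->
  (forall m, exists2 M : seq expo, uniq M &
     forall a, a \in M <-> min_exponent e setT m a) ->
  symbolic_power I_c m f -> star_monomials e x m f.
Proof.
move=> noethR c_gt0 exM.
have lt_es : (e < s)%N by rewrite -ce_s -[X in (X < _)%N]add0n ltn_add2r.
elim: m f => [|m IHm] f If.
  rewrite -[f]mulr1; apply: (idealM (ideal_genP _)).
  have -> : 1 = mon x [ffun=> 0%N].
    by rewrite /mon big1 // => j _; rewrite ffunE.
  by apply: star_monomials_mem.
have {IHm}/IHm Lf : symbolic_power I_c m f.
  move=> P assP; have primeP := assP.1; have := If P assP.
  move=> /(ideal_localizationP _ (ideal_genP _) primeP)[u [nPu Iu]].
  apply/(ideal_localizationP _ (ideal_genP _) primeP).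
  by exists u; split=> //; exact: ideal_exp_pred.
have [M uM ME] := exM m.
have [r fE] := star_monomials_span lt_es uM ME Lf.
rewrite fE big_seq; apply: ideal_sum; first exact: star_monomialsP.
move=> a Ma; apply: (star_tight_mul ce_s) => //; first exact/ME.
move=> A cA saA; apply: contrapT => nAr.
have [d primeP] := exists_associated_prime noethR (gen_ideal x A) nAr.
have := If _ (colon_associated cA primeP).
move=> /(ideal_localizationP _ (ideal_genP _) primeP)[u [nPu Iu]]; apply: nPu.
have Lu : star_monomials e x m.+1 (u * f).
  by apply: power_star_monomials; apply: star_ideal_exp_monomials Iu.
rewrite /colon /= mulrCA; apply: (idealM (gen_ideal _ _)).
apply: (star_syzygy ce_s (r := fun b => u * r b) reg uM _ _ Ma cA saA).
  by move=> b /ME.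
move: Lu; rewrite fE big_distrr /=.
by under eq_bigr do rewrite mulrA.
Qed.

End SymbolicPower.

(** * Enumeration of the minimal exponents *)

Section MinExponents.
Variables (s e : nat).
Local Notation expo := {ffun 'I_s -> nat}.
Implicit Types (a b : expo) (X Y : {set 'I_s}) (m k : nat).

(** The first argument [k] only ensures termination; any bound of [m] gives the
    same list.  A nonzero minimal exponent is the indicator of its support [Y]
    plus a minimal exponent on [Y], for the value of [m] decreased by
    [#|Y| - e]. *)
Fixpoint min_exponents k X m : seq expo :=
  if m == 0%N then [:: [ffun=> 0%N]] else
  if k is k'.+1 then
    [seq expo_add (indicator Y) a |
      Y <- enum [set Y : {set 'I_s} | Y \subset X & (e < #|Y| <= m + e)%N],
      a <- min_exponents k' Y (m + e - #|Y|)]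
  else [::].

Definition support a := [set j | (0 < a j)%N].

Lemma expo_add_support Y a : support a \subset Y ->
  support (expo_add (indicator Y) a) = Y.
Proof.
move=> /subsetP aY; apply/setP=> j; rewrite inE !ffunE.
have [//|jY /=] := boolP (j \in Y).
by apply/negbTE; apply: contra jY => aj; apply: aY; rewrite inE.
Qed.

Lemma sum_expo_add a b : (\sum_j expo_add a b j = \sum_j a j + \sum_j b j)%N.
Proof. by rewrite -big_split; apply: eq_bigr => j _; rewrite ffunE. Qed.

Lemma sum_indicatorT Y : (\sum_j indicator Y j = #|Y|)%N.
Proof.
rewrite -[in RHS](setTI Y) -sum_indicator.
by apply: eq_bigl => j; rewrite inE.
Qed.

Lemma sum_const_le a t (T : {set 'I_s}) : (forall j, j \in T -> a j = t) ->
  (#|T| * t <= \sum_j a j)%N.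
Proof.
move=> aT; rewrite (sum_setC_split a T) -sum_nat_const.
by rewrite [X in (_ <= X + _)%N](eq_bigr (fun=> t)) ?leq_addr.
Qed.

Lemma min_exponent0 X a : (e < #|X|)%N ->
  min_exponent e X 0 a <-> a = [ffun=> 0%N].
Proof.
move=> eX; split=> [[t [at_ _ sa ltT]]|->].
  have : (#|[set j in X | a j == t]| * t <= \sum_j a j)%N.
    by apply: sum_const_le => j; rewrite inE => /andP[_ /eqP].
  rewrite sa add0n => le_t; apply/ffunP=> j; rewrite ffunE.
  apply/eqP; rewrite -leqn0; apply: leq_trans (at_ j) _.
  by rewrite leqNgt; apply: contraL ltT => t0; rewrite -leqNgt -(leq_pmul2r t0).
exists 0%N; split=> [j|j _||]; rewrite ?ffunE ?muln0 //.
  by rewrite big1 // => j _; rewrite ffunE.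
rewrite (_ : [set j in X | _] = X) //; apply/setP=> j.
by rewrite inE ffunE eqxx andbT.
Qed.

Lemma mem_min_exponents k X m a : (m <= k)%N -> (e < #|X|)%N ->
  a \in min_exponents k X m <-> min_exponent e X m a.
Proof.
elim: k X m a => [|k IHk] X m a mk eX; have [m0|m0] := posnP m.
- by rewrite m0 min_exponent0 //= inE; split=> /eqP.
- by move: mk; rewrite leqNgt m0.
- by rewrite m0 min_exponent0 //= inE; split=> /eqP.
- rewrite /= eqn0Ngt m0 /=; split.
    case/allpairsPdep=> Y [b []]; rewrite mem_enum inE => /andP[YX /andP[eY Ym]].
    rewrite IHk //; last by lia.
    move=> [t [bt bY sb ltT]] ->; exists t.+1; split.
    + by move=> j; rewrite !ffunE; case: (j \in Y); rewrite ?add1n ?ltnS ?bt ?leqW ?bt.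
    + move=> j jX; have jY : j \notin Y by apply: contra jX; apply: (subsetP YX).
      by rewrite !ffunE (negPf jY) bY.
    + by rewrite sum_expo_add sum_indicatorT sb addnA subnKC // mulnS addnA.
    + apply: leq_trans ltT _; apply: subset_leq_card; apply/subsetP=> j.
      rewrite !inE !ffunE => /andP[jY /eqP ->].
      by rewrite jY (subsetP YX) //= add1n.
  move=> [t [at_ aX sa ltT]].
  have t0 : (0 < t)%N.
    rewrite lt0n; apply/eqP => t0; move: sa m0; rewrite big1 => [|j _].
      by rewrite t0 muln0; lia.
    by apply/eqP; rewrite -leqn0 -t0.
  pose Y := support a; pose b : expo := [ffun j => (a j).-1].
  have aE : a = expo_add (indicator Y) b.
    by apply/ffunP=> j; rewrite !ffunE inE; case: (a j).
  have YX : Y \subset X.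
    apply/subsetP=> j; rewrite inE; apply: contraLR => /aX ->; by [].
  have TY : [set j in X | a j == t] \subset [set j in Y | b j == t.-1].
    by apply/subsetP=> j; rewrite !inE ffunE => /andP[_ /eqP ->]; rewrite t0 eqxx.
  have ltT' := leq_trans ltT (subset_leq_card TY).
  have eY : (e < #|Y|)%N.
    apply: leq_trans ltT' _; apply: subset_leq_card.
    by apply/subsetP=> j; rewrite inE => /andP[].
  have sb : (#|Y| + \sum_j b j = m + e * t)%N.
    by rewrite -sa [in RHS]aE sum_expo_add sum_indicatorT.
  have : (#|[set j in Y | b j == t.-1]| * t.-1 <= \sum_j b j)%N.
    by apply: sum_const_le => j; rewrite inE => /andP[_ /eqP].
  move=> /(leq_trans (leq_mul (ltnW ltT') (leqnn _))) le_sb.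
  have et : (e * t = e + e * t.-1)%N by rewrite -mulnS prednK.
  (* The value m + e - #|Y| below is not truncated: at least e entries of b
     equal t.-1. *)
  have Ym : (#|Y| <= m + e)%N.
    move: sb le_sb; rewrite et.
    by move: #|Y| (\sum_j b j)%N (e * t.-1)%N => y z w; lia.
  apply/allpairsPdep; exists Y, b; split=> //.
    by rewrite mem_enum inE YX eY.
  rewrite IHk //; last by move: mk eY Ym; move: #|Y| => y; lia.
  exists t.-1; split=> //.
  + by move=> j; rewrite ffunE; have := at_ j; lia.
  + by move=> j; rewrite inE -leqNgt leqn0 => /eqP a0; rewrite ffunE a0.
  + move: sb Ym; rewrite et.
    by move: #|Y| (\sum_j b j)%N (e * t.-1)%N => y z w; lia.
Qed.

Lemma support_min_exponent X m a : min_exponent e X m a -> support a \subset X.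
Proof.
move=> [t [_ aX _ _]]; apply/subsetP=> j; rewrite inE.
by apply: contraLR => /aX ->.
Qed.

(** The set [Y] is recovered from the exponent as its support. *)
Lemma min_exponents_uniq k X m : (m <= k)%N -> uniq (min_exponents k X m).
Proof.
elim: k X m => [|k IHk] X m mk /=; case: eqP => // /eqP m0.
apply: allpairs_uniq_dep; first exact: enum_uniq.
  move=> Y; rewrite mem_enum inE => /andP[_ /andP[eY _]].
  by apply: IHk; lia.
have supp Y b : Y \in enum [set Y : {set 'I_s} | Y \subset X & (e < #|Y| <= m + e)%N] ->
    b \in min_exponents k Y (m + e - #|Y|) -> support (expo_add (indicator Y) b) = Y.
  rewrite mem_enum inE => /andP[_ /andP[eY _]].
  rewrite mem_min_exponents //; last by lia.
  by move=> /support_min_exponent; exact: expo_add_support.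
move=> u v /allpairsPdep[Y [b [YX Yb ->]]] /allpairsPdep[Z [d [ZX Zd ->]]] /= eq_bd.
have YZ : Y = Z by rewrite -(supp Y b YX Yb) eq_bd supp.
move: eq_bd; rewrite {}YZ => /ffunP eq_bd; congr (Tagged _ _).
by apply/ffunP=> j; have := eq_bd j; rewrite !ffunE => /addnI.
Qed.

(** The length of [min_exponents k X m] when [#|X| = e + d]; the summand for [i]
    counts the exponents whose support has [e + i.+1] elements. *)
Fixpoint min_exponent_count k d m : nat :=
  if m == 0%N then 1%N else
  if k is k'.+1 then
    (\sum_(0 <= i < d | i < m)
       'C(e + d, e + i.+1) * min_exponent_count k' i.+1 (m - i.+1))%N
  else 0%N.

Lemma size_min_exponents k X m : (e <= #|X|)%N ->
  size (min_exponents k X m) = min_exponent_count k (#|X| - e) m.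
Proof.
elim: k X m => [|k IHk] X m eX /=; case: eqP => // /eqP m0.
rewrite size_allpairs_dep sumnE big_map big_enum /=.
set G := fun n => min_exponent_count k (n - e) (m + e - n).
rewrite (eq_bigr (fun Y => G #|Y|)); last first.
  by move=> Y; rewrite inE => /andP[_ /andP[eY _]]; rewrite IHk // ltnW.
rewrite (partition_big (fun Y : {set 'I_s} => inord #|Y| : 'I_s.+1)
  (fun n => (e < n <= m + e)%N && (n <= #|X|)%N)) /=; last first.
  move=> Y; rewrite inE => /andP[YX eY].
  rewrite inordK ?eY ?subset_leq_card //.
  by rewrite ltnS -[X in (_ <= X)%N]card_ord max_card.
transitivity (\sum_(n < s.+1 | (e < n <= m + e) && (n <= #|X|)) 'C(#|X|, n) * G n)%N.
  apply: eq_bigr => n /andP[en nX].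
  rewrite (eq_bigr (fun=> G n)); last first.
    move=> Y /andP[_ /eqP <-]; rewrite inordK //.
    by rewrite ltnS -[X in (_ <= X)%N]card_ord max_card.
  rewrite sum_nat_const -cards_draws; congr (_ * _)%N.
  apply: eq_card => Y; rewrite [LHS]unfold_in /= !inE.
  have YE : (inord #|Y| == n :> 'I_s.+1) = (#|Y| == n).
    rewrite -val_eqE /= inordK //.
    by rewrite ltnS -[X in (_ <= X)%N]card_ord max_card.
  by rewrite YE; case: eqP => [->|]; rewrite ?andbF // en !andbT.
have [d XE] : exists d, #|X| = (e + d)%N by exists (#|X| - e)%N; rewrite subnKC.
have leX : (#|X|.+1 <= s.+1)%N by rewrite ltnS -[X in (_ <= X)%N]card_ord max_card.
rewrite -(big_ord_widen_cond _ (fun n => e < n <= m + e)%N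
  (fun n => 'C(#|X|, n) * G n)%N leX) XE addKn.
rewrite -(big_mkord (fun n => e < n <= m + e)%N (fun n => 'C(e + d, n) * G n)%N).
rewrite (@big_cat_nat _ _ _ e.+1) //=; last by rewrite ltnS leq_addr.
rewrite [X in (X + _)%N]big_nat_cond [X in (X + _)%N]big1 ?add0n; last by move=> n; lia.
rewrite -{1}[e.+1]add0n big_addn subSS addKn; apply: eq_big => i.
  by rewrite addnS ltnS leq_addl /= -addSn leq_add2r.
move=> _; rewrite /G; congr ('C(_, _) * min_exponent_count _ _ _)%N; lia.
Qed.

End MinExponents.

(** * The number of solutions and of chains *)

(** The bound [N] is kept apart from [m], because [m] decreases in the recursion
    while the type of the tuples does not. *)
Definition bounded_solutions (N h : nat) (w : nat -> nat) (m : nat) : nat :=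
  #|[pred x : h.-tuple 'I_N.+1 | [forall i, (0 < tnth x i)%N] &&
      (\sum_(i < h) w i * tnth x i == m)%N]|.

(** The number of positive solutions, computed by summing over the last
    unknown. *)
Fixpoint solutions h (w : nat -> nat) (m : nat) : nat :=
  if h is h'.+1 then
    (\sum_(1 <= v < m.+1 | w h' * v <= m) solutions h' w (m - w h' * v))%N
  else (m == 0)%N.

Lemma bounded_solutionsS N h w (m : nat) :
  bounded_solutions N h.+1 w m =
  (\sum_(1 <= v < N.+1 | w h * v <= m) bounded_solutions N h w (m - w h * v))%N.
Proof.
rewrite /bounded_solutions -sum1_card.
rewrite (reindex (fun p : 'I_N.+1 * h.-tuple 'I_N.+1 => [tuple of rcons p.2 p.1])) /=;
  last first.
  apply/onW_bij/inj_card_bij; last by rewrite card_prod !card_tuple card_ord expnS.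
  by move=> [v x] [u y] /(congr1 val) /rcons_inj [/val_inj -> ->].
have nth_rc (x : h.-tuple 'I_N.+1) v (i : 'I_h) :
    tnth [tuple of rcons x v] (widen_ord (leqnSn h) i) = tnth x i.
  by rewrite !(tnth_nth v) /= nth_rcons size_tuple ltn_ord.
have nth_max (x : h.-tuple 'I_N.+1) v : tnth [tuple of rcons x v] ord_max = v.
  by rewrite (tnth_nth v) /= nth_rcons size_tuple ltnn eqxx.
have allE (x : h.-tuple 'I_N.+1) (v : 'I_N.+1) :
    [forall i, (0 < tnth [tuple of rcons x v] i)%N] =
    [forall i, (0 < tnth x i)%N] && (0 < v)%N.
  apply/forallP/andP => [x0|[/forallP x0 v0] i].
    split; last by have := x0 ord_max; rewrite nth_max.
    by apply/forallP => i; have := x0 (widen_ord (leqnSn h) i); rewrite nth_rc.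
  case: (unliftP ord_max i) => [j|] ->; last by rewrite nth_max.
  suff -> : lift ord_max j = widen_ord (leqnSn h) j by rewrite nth_rc.
  by apply: val_inj; rewrite /= /bump leqNgt ltn_ord.
have sumE (x : h.-tuple 'I_N.+1) (v : 'I_N.+1) :
    (\sum_(i < h.+1) w i * tnth [tuple of rcons x v] i =
     \sum_(i < h) w i * tnth x i + w h * v)%N.
  by rewrite big_ord_recr /= nth_max; under eq_bigr do rewrite nth_rc.
under eq_bigl => p do rewrite inE allE sumE.
rewrite big_geq_mkord /=.
under [in RHS]eq_bigr do rewrite -sum1_card.
rewrite pair_big_dep /=; apply: eq_bigl => -[v x] /=; rewrite inE.
case: (0 < v)%N; rewrite ?andbF //= ?andbT.
case: [forall i, _]; rewrite ?andbF //=.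
by apply/eqP/andP => [<-|[le_m /eqP ->]]; rewrite ?subnK ?leq_addl ?addnK.
Qed.

Lemma sum_multiples (g : nat -> nat) (y N m : nat) : (0 < y)%N -> (m <= N)%N ->
  (\sum_(1 <= v < N.+1 | y * v <= m) g (m - y * v) =
   \sum_(1 <= v < m.+1 | y * v <= m) g (m - y * v))%N.
Proof.
move=> y0 mN; rewrite (@big_cat_nat _ _ _ m.+1) //= [X in (_ + X)%N]big_nat_cond.
rewrite [X in (_ + X)%N]big1 ?addn0 // => v /andP[/andP[mv _]].
by rewrite leqNgt (leq_trans mv) // leq_pmull.
Qed.

Lemma bounded_solutionsE N h w (m : nat) : (forall i, (i < h)%N -> (0 < w i)%N) ->
  (m <= N)%N -> bounded_solutions N h w m = solutions h w m.
Proof.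
elim: h m => [|h IHh] m w0 mN.
  rewrite /bounded_solutions /= -sum1_card.
  rewrite (eq_bigl (fun=> m == 0%N)); last first.
    move=> x; rewrite inE big_ord0 eq_sym; case: eqP; rewrite ?andbF ?andbT // => _.
    by apply/forallP => -[].
  case: eqP => _; last by rewrite big_pred0.
  by rewrite sum1_card card_tuple expn0.
rewrite bounded_solutionsS /= -(@sum_multiples _ _ N) ?w0 //.
apply: eq_bigr => v _; rewrite IHh // => [i ih|].
  by rewrite w0 // ltnW.
by apply: leq_trans mN; exact: leq_subr.
Qed.

Lemma eq_solutions h w w' m : (forall i, (i < h)%N -> w i = w' i) ->
  solutions h w m = solutions h w' m.
Proof.
elim: h m => [|h IHh] m //= ww'; rewrite ww' //.
by apply: eq_bigr => v _; apply: IHh => i /ltnW; exact: ww'.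
Qed.

(** The last unknown either is [1] or can be decreased by [1]. *)
Lemma solutions_step h w (m : nat) : (0 < w h)%N ->
  solutions h.+1 w m = if (w h <= m)%N then
    (solutions h w (m - w h) + solutions h.+1 w (m - w h))%N else 0%N.
Proof.
move=> w0; case: leqP => [wm|mw] /=; last first.
  rewrite big_nat_cond big1 // => v /andP[/andP[v0 _]].
  by rewrite leqNgt (leq_trans mw) // leq_pmulr.
rewrite [LHS](@big_cat_nat _ _ _ 2) //=; last by rewrite ltnS (leq_trans w0).
rewrite big_mkcond big_nat1 muln1 wm; congr addn.
rewrite -(@sum_multiples _ _ m.-1) //; last by lia.
rewrite big_add1 /= prednK; last by exact: leq_trans wm.
apply: congr_big_nat => // v _; rewrite mulnS; first by rewrite leq_subRL.
by rewrite subnDA.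
Qed.

Definition list_solutions b m := solutions (size b) (nth 0%N b) m.

Lemma num_solutionsE b m : all (leq 1) b -> num_solutions b m = list_solutions b m.
Proof.
move=> b0; apply: (@bounded_solutionsE m) => // i ib.
exact: (all_nthP 0%N b0).
Qed.

Lemma list_solutions_rcons b y m : (0 < y)%N ->
  list_solutions (rcons b y) m = if (y <= m)%N then
    (list_solutions b (m - y) + list_solutions (rcons b y) (m - y))%N else 0%N.
Proof.
move=> y0; rewrite /list_solutions size_rcons.
have yE : nth 0%N (rcons b y) (size b) = y by rewrite nth_rcons ltnn eqxx.
rewrite solutions_step yE //; case: leqP => // _; congr addn.
by apply: eq_solutions => i ib; rewrite nth_rcons ib.
Qed.

Definition binomial_chain e b : nat :=
  (\prod_(i < (size b).-1) 'C(e + nth 0 b i.+1, nth 0 b i.+1 - nth 0 b i))%N.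

Lemma binomial_chain_rcons e b z y :
  binomial_chain e (rcons (rcons b z) y) =
  (binomial_chain e (rcons b z) * 'C(e + y, y - z))%N.
Proof.
rewrite /binomial_chain !size_rcons /= big_ord_recr /=; congr muln.
  apply: eq_bigr => i _; rewrite ![nth _ (rcons (rcons b z) y) _]nth_rcons.
  by rewrite size_rcons !ltnS (ltnW (ltn_ord i)) ltn_ord.
by rewrite !nth_rcons !size_rcons !ltnn !eqxx ltnSn.
Qed.

Section SubsetElements.
Variable c : nat.
Implicit Types (B : {set 'I_c}) (d n : nat).

Definition below n : {set 'I_c} := [set i : 'I_c | (i < n)%N].

Lemma elements_positive B : all (leq 1) (elements B).
Proof. by apply/allP => y /mapP[i _ ->]. Qed.

Lemma elements_sorted B : sorted ltn (elements B).
Proof.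
rewrite /elements sorted_map /enum_mem -enumT.
apply: sorted_filter => [i j l|]; first exact: ltn_trans.
have := iota_ltn_sorted 0 c; rewrite -val_enum_ord sorted_map.
exact: sub_sorted.
Qed.

Lemma elements_setU1 B (i : 'I_c) : B \subset below i ->
  elements (i |: B) = rcons (elements B) i.+1.
Proof.
move=> Bi; apply: (irr_sorted_eq ltn_trans ltnn); first exact: elements_sorted.
  rewrite sorted_pairwise ?pairwise_rcons -?sorted_pairwise ?elements_sorted;
    try exact: ltn_trans.
  rewrite andbT; apply/allP => _ /mapP[j + ->]; rewrite mem_enum ltnS.
  by move/(subsetP Bi); rewrite inE.
move=> y; rewrite mem_rcons inE; apply/mapP/predU1P => [[j]|].
  rewrite mem_enum => /setU1P[-> ->|Bj ->]; [by left|right].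
  by apply: map_f; rewrite mem_enum.
case=> [->|/mapP[j Bj ->]].
  by exists i; rewrite // mem_enum setU11.
by exists j; rewrite // mem_enum setU1r // -mem_enum.
Qed.

(** A nonempty subset is determined by its largest element [d] and the rest of
    it, which lies below [d]. *)
Lemma subsets_below_sum (G : {set 'I_c} -> nat) n : (n <= c)%N ->
  (\sum_(B : {set 'I_c} | B \subset below n) G B =
   G set0 + \sum_(d < n) \sum_(B : {set 'I_c} | B \subset below d)
              (if insub (val d) is Some i then G (i |: B) else 0))%N.
Proof.
elim: n => [|n IHn] nc.
  rewrite big_ord0 addn0 (big_pred1 set0) // => B.
  rewrite (_ : below 0 = set0); first by rewrite subset0.
  by apply/setP => j; rewrite !inE.
rewrite big_ord_recr /= addnA -IHn; last exact: ltnW.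
rewrite insubT /=; set i := Sub n nc : 'I_c.
have below_i : below n.+1 = i |: below n.
  by apply/setP => j; rewrite !inE -val_eqE /= ltnS leq_eqVlt.
have i_below : i \notin below n by rewrite inE /= ltnn.
rewrite (bigID (fun B => i \in B)) /= addnC; congr addn.
  apply: eq_bigl => B; rewrite below_i; apply/andP/idP => [[BU iB]|Bn].
    apply/subsetP => j Bj; have /setU1P[ji|//] := subsetP BU _ Bj.
    by rewrite -ji Bj in iB.
  split; first by apply: subset_trans Bn (subsetUr _ _).
  by apply: contra i_below; apply: (subsetP Bn).
rewrite (reindex_onto (fun B => i |: B) (fun B => B :\ i)) /=; last first.
  by move=> B /andP[_ iB]; rewrite setD1K.
apply: eq_bigl => B; rewrite below_i setU11 andbT.
apply/andP/idP => [[BU /eqP BE]|Bn].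
  apply/subsetP => j Bj; have /setU1P[ji|//] := subsetP BU _ (setU1r _ Bj).
  by move: Bj; rewrite -BE ji !inE eqxx.
split; first exact: setUS.
rewrite setU1K //; by apply: contra i_below; apply: (subsetP Bn).
Qed.

(** The contribution to the sum of the statement of the subsets whose largest
    element is [d.+1], without the binomial coefficient of that element. *)
Definition chain_count e d m : nat :=
  (\sum_(B : {set 'I_c} | B \subset below d)
     list_solutions (rcons (elements B) d.+1) m *
     binomial_chain e (rcons (elements B) d.+1))%N.

Lemma elements0 : elements (set0 : {set 'I_c}) = [::].
Proof. by rewrite /elements enum_set0. Qed.

(** Decrease by [1] the unknown attached to the largest element [d.+1].  If it
    becomes [0], that element leaves the set, which becomes empty or acquires a
    largest element [i.+1] with [i < d]; otherwise the set is unchanged, which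
    is the summand [i = d]. *)
Lemma chain_count_step e d m : (d < c)%N ->
  chain_count e d m = if (d < m)%N then
    ((m == d.+1) + \sum_(i < d.+1) 'C(e + d.+1, e + i.+1) *
                      chain_count e i (m - d.+1))%N else 0%N.
Proof.
move=> dc; rewrite /chain_count; case: ltnP => [dm|md]; last first.
  by rewrite big1 // => B _; rewrite list_solutions_rcons // ltnNge md.
rewrite big_ord_recr /= binn mul1n addnA.
rewrite -/(chain_count e d (m - d.+1)).
under eq_bigr do rewrite list_solutions_rcons // dm mulnDl.
rewrite big_split /=; congr addn.
pose G B := (list_solutions (elements B) (m - d.+1) *
  binomial_chain e (rcons (elements B) d.+1))%N.
rewrite -/(chain_count _ _ _) (subsets_below_sum G) ?(ltnW dc) // /G.
rewrite elements0 /binomial_chain big_ord0 muln1; congr addn.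
  by rewrite /list_solutions /= subn_eq0 eqn_leq dm andbT.
apply: eq_bigr => i _; rewrite (insubT (fun j => j < c)%N (ltn_trans (ltn_ord i) dc)) /=.
rewrite big_distrr /=; apply: eq_bigr => B Bi.
rewrite elements_setU1 //= -/(binomial_chain _ _) binomial_chain_rcons.
rewrite mulnA mulnC; congr (_ * _)%N.
rewrite -[in RHS]bin_sub ?leq_add2l ?ltnS 1?ltnW //; congr 'C(_, _).
by rewrite subnDl.
Qed.

Lemma chain_countE e k d m : (d < c)%N -> (m <= k + d.+1)%N ->
  chain_count e d m =
    if (d < m)%N then min_exponent_count e k d.+1 (m - d.+1) else 0%N.
Proof.
elim: k d m => [|k IHk] d m dc mk; rewrite chain_count_step //;
  case: ltnP => // dm.
  have -> : m = d.+1 by lia.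
  rewrite subnn eqxx /= big1 // => i _.
  by rewrite chain_count_step ?muln0 // (leq_ltn_trans _ dc) // -ltnS.
have [->|md] := eqVneq m d.+1.
  rewrite subnn /= big1 // => i _.
  by rewrite chain_count_step ?muln0 // (leq_ltn_trans _ dc) // -ltnS.
have m0 : (m - d.+1 == 0)%N = false.
  by apply/negbTE; rewrite subn_eq0 -ltnNge ltn_neqAle eq_sym md.
rewrite /= m0 add0n [RHS]big_mkord [RHS]big_mkcond; apply: eq_bigr => i _.
rewrite IHk; last by have := ltn_ord i; lia.
  by case: ltnP => _ //; rewrite muln0.
by rewrite (leq_ltn_trans _ dc) // -ltnS.
Qed.

End SubsetElements.

Lemma num_generatorsE s c m : (c <= s)%N -> (0 < m)%N ->
  num_generators s c m = min_exponent_count (s - c) m c m.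
Proof.
move=> cs m0; case: m m0 => // m _.
pose G (B : {set 'I_c}) := (num_solutions (elements B) m.+1 *
  'C(s, c - last 0 (elements B)) * binomial_chain (s - c) (elements B))%N.
have G0 : G set0 = 0%N.
  by rewrite /G elements0 num_solutionsE.
transitivity (\sum_(B : {set 'I_c} | B \subset below c c) G B)%N.
  rewrite [RHS](bigD1 set0) ?sub0set //= G0 add0n; apply: eq_bigl => B.
  suff -> : B \subset below c c by [].
  by apply/subsetP => j _; rewrite inE.
rewrite subsets_below_sum // G0 add0n /= big_mkord [RHS]big_mkcond.
apply: eq_bigr => d _; rewrite (insubT (fun j => j < c)%N (ltn_ord d)) /=.
transitivity ('C(s, c - d.+1) * chain_count c (s - c) d m.+1)%N.
  rewrite big_distrr; apply: eq_bigr => B Bd; rewrite /G elements_setU1 //=.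
  rewrite num_solutionsE ?last_rcons; first by rewrite mulnAC mulnC mulnA.
  by rewrite all_rcons /= elements_positive.
rewrite (@chain_countE _ _ m) //; last by lia.
rewrite ltnS; case: leqP => dm; last by rewrite muln0.
rewrite subnK // -[in RHS]bin_sub; last by have := ltn_ord d; lia.
by congr ('C(_, _) * _)%N; have := ltn_ord d; lia.
Qed.

(** * Minimal numbers of generators *)

Lemma identity_factor_size (K : fieldType) (T : eqType) (l : seq T) q
    (V : T -> 'I_q -> K) (U : 'I_q -> T -> K) : uniq l ->
  {in l &, forall a b, \sum_(i < q) V a i * U i b = (a == b)%:R} ->
  (size l <= q)%N.
Proof.
move=> ul VU; pose t := tnth (in_tuple l).
pose Vm := \matrix_(i < size l, j < q) V (t i) j.
pose Um := \matrix_(i < q, j < size l) U i (t j).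
have VU1 : Vm *m Um = 1%:M.
  apply/matrixP=> i j; rewrite !mxE.
  under eq_bigr do rewrite !mxE.
  rewrite VU ?mem_tnth //; congr (_%:R); rewrite -val_eqE /=.
  by rewrite /t !(tnth_nth (t i)) nth_uniq.
rewrite -[X in (X <= _)%N](mxrank1 K) -VU1.
exact: leq_trans (mxrankM_maxl _ _) (rank_leq_col _).
Qed.

Lemma ideal_gen_range_add (R : comNzRingType) (N : set R) q (u : 'I_q -> R) f :
  is_ideal N -> ideal_gen (range u `|` N)%classic f ->
  exists V : 'I_q -> R, N (f - \sum_(i < q) V i * u i).
Proof.
move=> idN; pose J : set R :=
  [set f | exists V : 'I_q -> R, N (f - \sum_(i < q) V i * u i)]%classic.
apply: (@ideal_gen_sub _ _ J); first split.
- by exists (fun=> 0); rewrite big1 ?subr0; [exact: ideal0|move=> i; rewrite mul0r].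
- move=> g h [V NV] [W NW]; exists (fun i => V i + W i).
  under eq_bigr do rewrite mulrDl.
  by rewrite big_split opprD addrACA; exact: idealD.
- move=> a g [V NV]; exists (fun i => a * V i).
  under eq_bigr do rewrite -mulrA.
  by rewrite -big_distrr -mulrBr; exact: idealM.
- move=> h [[i _ <-]|Nf]; last first.
    by exists (fun=> 0); rewrite big1 ?subr0 // => i; rewrite mul0r.
  exists (fun j => (j == i)%:R); rewrite (bigD1 i) //= eqxx mul1r big1 ?addr0.
    by rewrite subrr; exact: ideal0.
  by move=> j /negPf ->; rewrite mul0r.
Qed.

(** For a polynomial ring, [ev] is the constant term; it vanishes on the forms
    of the family and hence on the coefficients of every relation between the
    minimal generators. *)
Section MinimalGenerators.
Variables (R : idomainType) (k : fieldType) (ev : {rmorphism R -> k}).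
Variables (s c e : nat) (x : 'I_s -> R).
Hypothesis ce_s : (c + e = s)%N.
Hypothesis lt_es : (e < s)%N.
Hypothesis reg : regular_family x c.
Hypothesis ev_x : forall j, ev (x j) = 0.
Local Notation expo := {ffun 'I_s -> nat}.
Local Notation I_c := (star_ideal c x).
Implicit Types (a b : expo) (A B D : {set 'I_s}) (f g : R).

Lemma ev_gen A f : gen x A f -> ev f = 0.
Proof.
have idker : is_ideal [set f | ev f = 0]%classic.
  split=> [|g h /= g0 h0|g h /= h0]; first exact: rmorph0.
    by rewrite rmorphD g0 h0 addr0.
  by rewrite rmorphM h0 mulr0.
by apply: (gen_sub idker) => j _; exact: ev_x.
Qed.

Lemma min_exponent_tight_set m a : min_exponent e setT m a ->
  exists A, #|A| = c /\ (\sum_(j in A) a j = m)%N.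
Proof.
move=> [t [_ _ sa /ltnW]]; rewrite -bin_gt0 -cards_draws => /card_gt0P[Y].
rewrite inE => /andP[/subsetP YT /eqP cY]; exists (~: Y); split.
  by apply/(cocardE ce_s); rewrite setCK.
apply/eqP; rewrite -(eqn_add2r (e * t)) -sa (sum_setC_split a (~: Y)) setCK.
rewrite eqn_add2l eq_sym -cY -sum_nat_const; apply/eqP/eq_bigr => j /YT.
by rewrite !inE => /eqP.
Qed.

Lemma ev_syzygy m (M : seq expo) (r : expo -> R) : uniq M ->
  {in M, forall a, min_exponent e setT m a} ->
  \sum_(a <- M) r a * mon x a = 0 -> {in M, forall a, ev (r a) = 0}.
Proof.
move=> uM Mmin r0 a Ma; have [A [cA saA]] := min_exponent_tight_set (Mmin a Ma).
apply: (@ev_gen A); apply: (star_syzygy ce_s reg uM Mmin _ Ma cA saA).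
by rewrite r0; exact: ideal0 (star_monomialsP _ _ _).
Qed.

Section Bound.
Variables (m : nat) (M : seq expo).
Hypotheses (uM : uniq M) (ME : forall a, a \in M <-> min_exponent e setT m a).

Let Mmin : {in M, forall a, min_exponent e setT m a}.
Proof. by move=> a /ME. Qed.

Lemma star_monomials_mem_seq a : a \in M -> star_monomials e x m (mon x a).
Proof.
by move=> /ME Ma; apply: star_monomials_mem; exact: min_exponent_star Ma.
Qed.

Lemma star_monomials_seq_sub J : is_ideal J -> (forall a, a \in M -> J (mon x a)) ->
  forall f, star_monomials e x m f -> J f.
Proof.
move=> idJ MJ f /(star_monomials_span lt_es uM ME)[r ->].
rewrite big_seq; apply: ideal_sum => // a Ma; apply: idealM => //; exact: MJ.
Qed.

(** Write the monomials in terms of the generators [u] modulo [N] and the [u]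
    in terms of the monomials.  Comparing coefficients, up to relations, and
    applying [ev] factors an identity matrix through a space of dimension [q];
    the second hypothesis makes the contribution of [N] vanish at the monomials
    selected by [P]. *)
Lemma generators_bound (N : set R) (P : pred expo) q (u : 'I_q -> R) :
  is_ideal N ->
  (forall h, N h -> exists2 H : expo -> R, h = \sum_(a <- M) H a * mon x a &
     forall a, P a -> ev (H a) = 0) ->
  generates_quotient (star_monomials e x m) N u ->
  (size (filter P M) <= q)%N.
Proof.
move=> idN NH Lu; have repr f : star_monomials e x m f ->
    exists V : 'I_q -> R, N (f - \sum_(i < q) V i * u i).
  by rewrite {1}Lu; exact: ideal_gen_range_add.
have /choice[U uE] (i : 'I_q) :
    exists U : expo -> R, u i = \sum_(a <- M) U a * mon x a.
  apply: (star_monomials_span lt_es uM ME); rewrite Lu.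
  by apply: ideal_gen_mem; left; exists i.
have /choice[V VP] (a : expo) : exists V : 'I_q -> R,
    a \in M -> N (mon x a - \sum_(i < q) V i * u i).
  have [Ma|_] := boolP (a \in M); last by exists (fun=> 0).
  by have [V NV] := repr _ (star_monomials_mem_seq Ma); exists V.
apply: (@identity_factor_size k _ _ _ (fun a i => ev (V a i)) (fun i b => ev (U i b))).
  exact: filter_uniq.
move=> a b; rewrite !mem_filter => /andP[_ Ma] /andP[Pb Mb].
have [H HE H0] := NH _ (VP a Ma).
have : \sum_(b <- M) ((\sum_(i < q) V a i * U i b) + H b - (b == a)%:R) * mon x b = 0.
  transitivity (\sum_(i < q) V a i * u i + \sum_(b <- M) H b * mon x b - mon x a).
    under eq_bigr do rewrite mulrDl mulrDl mulNr.
    rewrite !big_split /= sumrN; congr (_ + _ - _).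
      under [RHS]eq_bigr do rewrite uE big_distrr.
      rewrite exchange_big; apply: eq_bigr => l _; rewrite big_distrl.
      by apply: eq_bigr => i _; rewrite /= mulrA.
    rewrite (bigD1_seq a) //= eqxx mul1r big1 ?addr0 // => l /negPf ->.
    by rewrite mul0r.
  by rewrite -HE; ring.
move=> /(ev_syzygy uM Mmin)/(_ b Mb)/eqP.
rewrite rmorphB rmorphD H0 // addr0 rmorph_sum subr_eq0 rmorph_nat => /eqP.
rewrite eq_sym => <-; by apply: eq_bigr => i _; rewrite rmorphM.
Qed.

Lemma min_gens_star_monomials : min_gens (star_monomials e x m) (size M).
Proof.
split.
  exists (fun i => mon x (tnth (in_tuple M) i)).
  apply/seteqP; split.
    apply: star_monomials_seq_sub; first exact: ideal_genP.
    move=> a /(tnthP (in_tuple M))[i ->]; apply: ideal_gen_mem.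
    by left; exists i.
  apply: ideal_gen_sub; first exact: star_monomialsP.
  move=> _ [[i _ <-]|->]; last exact: ideal0 (star_monomialsP _ _ _).
  by apply: star_monomials_mem_seq; rewrite mem_tnth.
move=> q u Lu; rewrite -[X in (size X <= _)%N](filter_predT M).
apply: (generators_bound _ _ Lu).
  by split=> [//|f g -> ->|f g ->]; rewrite ?addr0 ?mulr0.
move=> h ->; exists (fun=> 0) => [|a _]; last exact: rmorph0.
by rewrite big1 // => a _; rewrite mul0r.
Qed.

Hypotheses (e_gt0 : (0 < e)%N) (m_gt0 : (0 < m)%N).

Definition pure_exponents :=
  [seq pure_exponent m D | D <- enum [set D : {set 'I_s} | D \subset setT & #|D| == e.+1]].

Lemma mem_pure_exponents a :
  reflect (exists2 D : {set 'I_s}, #|D| = e.+1 & a = pure_exponent m D)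
          (a \in pure_exponents).
Proof.
apply: (iffP mapP) => [[D]|[D cD ->]]; last first.
  by exists D; rewrite // mem_enum inE subsetT cD /=.
by rewrite mem_enum inE => /andP[_ /eqP cD] ->; exists D.
Qed.

Lemma size_impure :
  size (filter [pred a | a \notin pure_exponents] M) = (size M - 'C(s, c - 1))%N.
Proof.
rewrite size_filter -(count_predC (mem pure_exponents) M).
rewrite -[X in (X + _ - _)%N]size_filter.
suff -> : size (filter (mem pure_exponents) M) = 'C(s, c - 1) by rewrite addKn.
have /perm_size -> : perm_eq (filter (mem pure_exponents) M) pure_exponents.
  apply: uniq_perm; first exact: filter_uniq.
    by rewrite map_inj_uniq ?enum_uniq //; exact: pure_exponent_inj.
  move=> a; rewrite mem_filter /=; apply: andb_idr.
  by move=> /mem_pure_exponents[D cD ->]; apply/ME; exact: pure_exponent_min.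
rewrite size_map -cardE cards_draws cardsT card_ord -bin_sub //.
by congr 'C(_, _); lia.
Qed.

(** The [m]-th powers of the generators of [I_c] are minimal generators of the
    symbolic power that belong to [I_c^m].  Any other product of [m] generators
    of [I_c] is a proper multiple of a minimal generator, so that it does not
    affect the bound. *)
Lemma sdefect_star_monomials :
  min_gens_quotient (star_monomials e x m) (ideal_exp I_c m)
    (size M - 'C(s, c - 1)).
Proof.
rewrite -size_impure; set M' := filter _ M; split.
  exists (fun i => mon x (tnth (in_tuple M') i)).
  apply/seteqP; split.
    apply: star_monomials_seq_sub; first exact: ideal_genP.
    move=> a Ma; have [/mem_pure_exponents[D cD ->]|Za] := boolP (a \in pure_exponents).
      by apply: ideal_gen_mem; right; exact: (pure_ideal_exp ce_s).
    have /(tnthP (in_tuple M'))[i ->] : a \in M' by rewrite mem_filter /= Za.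
    by apply: ideal_gen_mem; left; exists i.
  apply: ideal_gen_sub; first exact: star_monomialsP.
  move=> f [[i _ <-]|If].
    apply: star_monomials_mem_seq; have := mem_tnth i (in_tuple M').
    by rewrite mem_filter => /andP[].
  by apply: power_star_monomials; exact: star_ideal_exp_monomials If.
move=> q u Lu; apply: (generators_bound (ideal_genP _) _ Lu) => h.
move=> /(star_ideal_exp_monomials ce_s reg).
set J : set R := [set h | exists2 H : expo -> R, h = \sum_(a <- M) H a * mon x a &
   forall a, a \notin pure_exponents -> ev (H a) = 0]%classic.
apply: (@ideal_gen_sub _ _ J); first split.
- exists (fun=> 0) => [|a _]; last exact: rmorph0.
  by rewrite big1 // => a _; rewrite mul0r.
- move=> f g [H -> H0] [G -> G0]; exists (fun a => H a + G a) => [|a Za].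
    by rewrite -big_split; apply: eq_bigr => a _; rewrite mulrDl.
  by rewrite rmorphD H0 // G0 // addr0.
- move=> g f [H -> H0]; exists (fun a => g * H a) => [|a Za].
    by rewrite big_distrr; apply: eq_bigr => a _; rewrite /= mulrA.
  by rewrite rmorphM H0 // mulr0.
move=> _ [b pb <-].
have [a Ma ab] := star_exponent_min lt_es (power_exponent_star pb).
have [g bE] := mon_le x ab.
exists (fun d => (d == a)%:R * mon x [ffun j => (b j - a j)%N]).
  rewrite (bigD1_seq a) //=; last exact/ME.
  rewrite eqxx mul1r big1 ?addr0 => [|d /negPf ->]; last by rewrite !mul0r.
  by rewrite -monD; congr mon; apply/ffunP=> j; rewrite !ffunE subnK.
move=> d Zd; have [da|_] := eqVneq d a; last by rewrite mul0r rmorph0.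
rewrite mul1r; have [j bj] : exists j, (a j < b j)%N.
  apply: contrapT => nb; move/negP: Zd; apply; apply/mem_pure_exponents.
  apply: power_exponent_min => //; rewrite da //.
  suff <- : b = a by [].
  apply/ffunP => j; apply/eqP; rewrite eqn_leq ab andbT leqNgt.
  by apply/negP => lt_ab; apply: nb; exists j.
rewrite /mon rmorph_prod (bigD1 j) //= rmorphXn ev_x ffunE expr0n subn_eq0 leqNgt bj.
by rewrite mul0r.
Qed.

End Bound.
End MinimalGenerators.

(** A form with a nonzero constant term is constant, hence a unit, and a regular
    sequence generates a proper ideal. *)
Lemma regular_form_ev0 (k : fieldType) (n c : nat) (f : 'I_c.+1 -> {mpoly k[n]}) :
  regular_sequence f -> (exists d : nat, f ord0 \is d.-homog) -> (f ord0)@_0%MM = 0.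
Proof.
move=> [_ f1] [d homf]; apply: contrapT => /eqP f0; apply: f1.
have d0 : d = 0%N.
  apply: contrapT => /eqP d0; move/eqP: f0; apply.
  have dd : mdeg (0%MM : 'X_{1..n}) != d by rewrite mdeg0 eq_sym.
  exact: dhomog_nemf_coeff homf dd.
have fC : f ord0 = ((f ord0)@_0%MM)%:MP.
  apply/mpolyP => l; rewrite mcoeffC; have [<-|l0] := eqVneq 0%MM l.
    by rewrite mulr1.
  have ld : mdeg l != d by rewrite d0 mdeg_eq0 eq_sym.
  by rewrite mulr0 (dhomog_nemf_coeff homf ld).
have -> : 1 = ((f ord0)@_0%MM)^-1%:MP * f ord0.
  by rewrite [X in _ * X]fC -mpolyCM mulVf // mpolyC1.
by apply: (idealM (ideal_genP _)); apply: ideal_gen_mem; exists ord0.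
Qed.

Theorem corollary4p13 (k : fieldType) (n s c : nat) (hc : (1 <= c)%N)
    (hcs : (c < s)%N) (F : 'I_s -> {mpoly k[n.+1]})
    (F_form : forall j : 'I_s, exists d : nat, F j \is d.-homog)
    (F_regular : forall sigma : 'I_c.+1 -> 'I_s, injective sigma ->
      regular_sequence (fun i : 'I_c.+1 => F (sigma i)))
    (m : nat) (hm : (1 <= m)%N) :
  min_gens (symbolic_power (star_ideal c F) m) (num_generators s c m) /\
  sdefect (star_ideal c F) m (num_generators s c m - 'C(s, c - 1))%N.
Proof.
have reg : regular_family F c by exact: regular_sequences_family.
have ce_s : (c + (s - c) = s)%N by rewrite subnKC // ltnW.
have e_gt0 : (0 < s - c)%N by rewrite subn_gt0.
have lt_es : (s - c < s)%N by rewrite ltn_subrL hc (leq_trans _ hcs).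
have F0 j : (F j)@_0%MM = 0.
  (* Any c + 1 indices of which j is the first. *)
  pose sigma (i : 'I_c.+1) := tperm (widen_ord hcs ord0) j (widen_ord hcs i).
  have sigma_inj : injective sigma.
    by move=> i i' /perm_inj /(congr1 val) /= /val_inj.
  have := regular_form_ev0 (F_regular sigma sigma_inj).
  by rewrite /sigma tpermL; apply.
have lt_eT : (s - c < #|[set: 'I_s]|)%N by rewrite cardsT card_ord.
have memM m' (a : {ffun 'I_s -> nat}) : a \in min_exponents (s - c) m' setT m' <->
    min_exponent (s - c) setT m' a.
  exact: mem_min_exponents.
have uM m' : uniq (min_exponents (s - c) m' [set: 'I_s] m')
  by exact: min_exponents_uniq.
have symE : symbolic_power (star_ideal c F) m = star_monomials (s - c) F m.
  apply/seteqP; split=> f; last exact: (star_monomials_symbolic ce_s reg).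
  apply: (symbolic_star_monomials ce_s reg) => //; first exact: mpoly_noetherian.
  by move=> m'; exists (min_exponents (s - c) m' setT m').
have <- : size (min_exponents (s - c) m [set: 'I_s] m) = num_generators s c m.
  rewrite size_min_exponents ?(ltnW lt_eT) // num_generatorsE ?(ltnW hcs) //.
  by rewrite cardsT card_ord subKn // ltnW.
rewrite /sdefect symE; split.
  exact: (min_gens_star_monomials (ev := mcoeff 0%MM) ce_s lt_es reg F0 (uM m) (memM m)).
exact: (sdefect_star_monomials (ev := mcoeff 0%MM) ce_s lt_es reg F0 (uM m) (memM m)).
Qed.
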